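(* Consider the HK system with communication noise (S4) under assumption (A2), with $n\ge3$ and $r_1=\cdots=r_n\in[\frac1{n-1},1)$. Then for every initial state $x(0)\in[0,1]^n$, almost surely $\underline d_{\mathcal V}=0$ and $$\overline d_{\mathcal V}=\begin{cases}\frac{2\eta(n-1)}{n} & \text{if }\eta\le\frac{nr_1}{2(n-1)},\\ 1&\text{otherwise}.\end{cases}$$ Moreover, for any $\alpha>0$ let $c_\alpha=\frac{2\eta(n-1)}{n}-\alpha$ if $\eta\le\frac{nr_1}{2(n-1)}$ and $c_\alpha=1$ otherwise; let $\tau_0=0$ and for $k\ge1$, $\tau_k=\min\{s>\tau_{k-1}:d_{\mathcal V}(s)\le\alpha\}$ if $k$ is odd, $\tau_k=\min\{s>\tau_{k-1}:d_{\mathcal V}(s)\ge c_\alpha\}$ if $k$ is even. Then there exist constants $\lambda_5\in(0,1)$, $\Lambda_5>0$ depending only on $n,\eta,\underline\rho,\alpha,r_1$ such that $P(\tau_{2j+2}-\tau_{2j}>t)\le(1-\lambda_5)^{\lfloor t/\Lambda_5\rfloor}$ for all $j\ge0$ and $t\ge0$.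
   Context: Agent set $\mathcal V=\{1,\dots,n\}$, confidence thresholds $r_i\in(0,1]$, noise amplitude $\eta>0$. Opinions $x_i(t)\in[0,1]$, $x(t)=(x_1(t),\dots,x_n(t))$, $t=0,1,\dots$. Neighbor set $\mathcal N_i(t)=\{j\in\mathcal V:|x_j(t)-x_i(t)|\le r_i\}$ (contains $i$), $\Pi_{[0,1]}(y)=\min\{1,\max\{0,y\}\}$, $d_{\mathcal V}(t)=\max_{i,j}|x_i(t)-x_j(t)|$, $\underline d_{\mathcal V}=\liminf_{t\to\infty}d_{\mathcal V}(t)$, $\overline d_{\mathcal V}=\limsup_{t\to\infty}d_{\mathcal V}(t)$. System (S4): for all $i\in\mathcal V$, $t\ge0$, $x_i(t+1)=\Pi_{[0,1]}\big(|\mathcal N_i(t)|^{-1}\sum_{j\in\mathcal N_i(t)}[x_j(t)+\zeta_{ji}(t)]\big)$, with random communication noises $\zeta_{ji}(t)\in[-\eta,\eta]$ and $\zeta_{ii}(t)\equiv0$. Assumption (A2): with $\mathcal E(t)=\{(i,j):i\in\mathcal V,j\in\mathcal N_i(t)\setminus\{i\}\}$, there is $\underline\rho>0$ such that for every $t\ge0$ and any states $x(0),\dots,x(t)\in[0,1]^n$ with $\mathcal E(t)\ne\emptyset$, $P\big(\bigcap_{(i,j)\in\mathcal E(t)}\{\zeta_{ji}(t)\in[a_i^j,b_i^j]\}\mid x(0),\dots,x(t)\big)\ge\underline\rho\prod_{(i,j)\in\mathcal E(t)}(b_i^j-a_i^j)$ for all $-\eta\le a_i^j<b_i^j\le\eta$.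 *)

(* Defs.v *)
From HB Require Import structures.
From mathcomp Require Import all_boot all_order all_algebra.
From mathcomp Require Import all_classical all_reals all_analysis.
Set Implicit Arguments. Unset Strict Implicit. Unset Printing Implicit Defensive.
Import Order.TTheory GRing.Theory Num.Theory.
Import numFieldNormedType.Exports.
Local Open Scope classical_set_scope.
Local Open Scope ring_scope.

Section HK.
Variables (R : realType) (n : nat).

Definition proj01 (y : R) : R := Num.min 1 (Num.max 0 y).

Definition nbrs (r : R) (x : 'I_n -> R) (i : 'I_n) : {set 'I_n} :=
  [set j | `|x j - x i| <= r].

(* one step of (S4); z j i is the noise zeta_{ji}(t) *)
Definition hk_step (r : R) (x : 'I_n -> R) (z : 'I_n -> 'I_n -> R) : 'I_n -> R :=
  fun i => proj01 ((#|nbrs r x i|%:R)^-1 * \sum_(j in nbrs r x i) (x j + z j i)).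

Fixpoint hk_traj (T : Type) (r : R) (x0 : 'I_n -> R)
  (zeta : nat -> 'I_n -> 'I_n -> T -> R) (t : nat) (w : T) : 'I_n -> R :=
  match t with
  | 0 => x0
  | t'.+1 => hk_step r (hk_traj r x0 zeta t' w) (fun j i => zeta t' j i w)
  end.

Definition diam (x : 'I_n -> R) : R :=
  \big[Num.max/0]_(i < n) \big[Num.max/0]_(j < n) `|x i - x j|.

Definition edges (r : R) (x : 'I_n -> R) : {set 'I_n * 'I_n} :=
  [set e | (e.2 \in nbrs r x e.1) && (e.2 != e.1)].

Definition hist_events d (T : measurableType d) (r : R) (x0 : 'I_n -> R)
  (zeta : nat -> 'I_n -> 'I_n -> T -> R) (t : nat) : set (set T) :=
  <<s [set: T], [set A | exists s i (B : set R), (s <= t)%N /\ measurable B /\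
        A = (fun w => hk_traj r x0 zeta s w i) @^-1` B] >>.

Definition noise_ok d (T : measurableType d) (eta : R)
  (zeta : nat -> 'I_n -> 'I_n -> T -> R) : Prop :=
  (forall t j i, measurable_fun [set: T] (zeta t j i)) /\
  (forall t j i w, - eta <= zeta t j i w <= eta) /\
  (forall t i w, zeta t i i w = 0).

(* Assumption (A2), with the conditional probability given x(0..t) expressed
   through events of the history sigma-algebra intersected with {E(t) = E}. *)
Definition assumption_A2 d (T : measurableType d) (P : probability T R)
  (r eta rho : R) (x0 : 'I_n -> R) (zeta : nat -> 'I_n -> 'I_n -> T -> R) : Prop :=
  forall (t : nat) (E : {set 'I_n * 'I_n}) (a b : 'I_n * 'I_n -> R) (A : set T),
    hist_events r x0 zeta t A ->
    E != finset.set0 ->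
    (forall e, e \in E -> - eta <= a e /\ a e < b e /\ b e <= eta) ->
    ((rho * \prod_(e in E) (b e - a e))%:E *
       P (A `&` [set w | edges r (hk_traj r x0 zeta t w) = E]) <=
     P (A `&` [set w | edges r (hk_traj r x0 zeta t w) = E]
          `&` [set w | forall e, e \in E ->
                 (a e <= zeta t e.2 e.1 w <= b e)%R]))%E.

Definition next_hit (Q : nat -> Prop) (s0 : nat) : option nat :=
  match pselect (exists s, `[< (s0 < s)%N /\ Q s >]) with
  | left h => Some (ex_minn h)
  | right _ => None
  end.

(* the stopping times tau_k (None = +infinity) *)
Fixpoint tau (dseq : nat -> R) (alpha c : R) (k : nat) : option nat :=
  match k with
  | 0 => Some 0%N
  | k'.+1 =>
      match tau dseq alpha c k' with
      | None => None
      | Some s => next_hit (fun s' => if odd k'.+1 then dseq s' <= alpha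
                                     else c <= dseq s') s
      end
  end.

Definition gap_event (T : Type) (dseq : T -> nat -> R) (alpha c : R)
  (j : nat) (t : R) : set T :=
  [set w | match tau (dseq w) alpha c (2 * j + 2), tau (dseq w) alpha c (2 * j) with
           | Some a, Some b => t < (a - b)%:R
           | _, _ => True
           end].

End HK.

Definition dbar_val (R : realType) (n : nat) (r eta : R) : R :=
  if eta <= n%:R * r / (2 * (n%:R - 1)) then 2 * eta * (n%:R - 1) / n%:R else 1.

Definition c_alpha (R : realType) (n : nat) (r eta alpha : R) : R :=
  if eta <= n%:R * r / (2 * (n%:R - 1)) then 2 * eta * (n%:R - 1) / n%:R - alpha
  else 1.

(* Main.v *)
Require Import Defs.
From HB Require Import structures.
From mathcomp Require Import all_boot all_order all_algebra.
From mathcomp Require Import all_classical all_reals all_analysis.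
From mathcomp Require Import measurable_realfun lra zify ring.
Set Implicit Arguments.
Unset Strict Implicit.
Unset Printing Implicit Defensive.
Import Order.TTheory GRing.Theory Num.Theory.
Import numFieldNormedType.Exports.
Local Open Scope classical_set_scope.
Local Open Scope ring_scope.

(* By (A2), any strategy that confines the noises received by agent i to a fixed
   interval of positive length, and that switches interval only according to the
   current state, is followed for a bounded number of steps with a conditional
   probability bounded below.  It thus suffices to steer the system.

   Since r >= 1/(n-1), some two agents are always neighbours.  Pushing every noise
   down makes the highest non-isolated agent descend, until all non-isolated
   agents sit at 0.  Pushing up moves this cluster towards the lowest isolated
   agent, which it absorbs; repeating, all agents merge, and are pushed to 0.
   From there the whole group is raised to any prescribed interval.  With
   delta = eta (n-1)/n, a last step at extreme noises gives diameter about
   2 delta; if 2 delta > r it can instead leave one agent at 0 and throw the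
   others out of its reach, after which they are pushed up to 1.

   Once the diameter is at most r, all agents average the same values, so the
   diameter never exceeds 2 delta again when 2 delta <= r.  Repeating the attempt
   over successive time windows gives the almost sure and geometric estimates. *)

(** * Averages of opinions and of noises over a set of agents *)

Section Averages.
Context {R : realType} {n : nat}.
Implicit Types (N : {set 'I_n}) (x : 'I_n -> R).

Lemma natr_cardD1 N i : i \in N -> #|N :\ i|%:R = #|N|%:R - 1 :> R.
Proof. by move=> iN; rewrite (cardsD1 i N) iN natrD addrAC subrr add0r. Qed.

Definition mean N x : R := #|N|%:R^-1 * \sum_(j in N) x j.

Lemma mean_ge N x l :
  (0 < #|N|)%N -> (forall j, j \in N -> l <= x j) -> l <= mean N x.
Proof.
move=> N0 lx; rewrite /mean mulrC ler_pdivlMr ?ltr0n//.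
rewrite mulr_natr -sumr_const; exact: ler_sum.
Qed.

Lemma mean_le N x h :
  (0 < #|N|)%N -> (forall j, j \in N -> x j <= h) -> mean N x <= h.
Proof.
move=> N0 xh; rewrite /mean mulrC ler_pdivrMr ?ltr0n//.
rewrite mulr_natr -sumr_const; exact: ler_sum.
Qed.

(* At most one member of [N] exceeds [h], hence the excess is at least halved. *)
Lemma mean_le_one_outlier N x a h e :
  (1 < #|N|)%N -> 0 <= e -> (forall j, j \in N -> j != a -> x j <= h) ->
  x a <= h + e -> mean N x <= h + e / 2.
Proof.
move=> N1 e0 xh xa.
have N0 : (0 : R) < #|N|%:R by rewrite ltr0n (leq_trans _ N1).
have N2 : (2 : R) <= #|N|%:R by rewrite ler_nat.
suff : \sum_(j in N) x j <= h * #|N|%:R + e.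
  move=> H; rewrite /mean mulrC ler_pdivrMr//; nra.
have [aN|aN] := boolP (a \in N).
  rewrite (bigD1 a)//=.
  have -> : h * #|N|%:R + e = (h + e) + h * (#|N|%:R - 1) by lra.
  rewrite lerD//.
  rewrite -(natr_cardD1 aN) mulr_natr -sumr_const (eq_bigl (fun j => j \in N :\ a)); last first.
    by move=> j; rewrite !inE andbC.
  by apply: ler_sum => j; rewrite !inE => /andP[ja jN]; exact: xh.
rewrite -[X in X <= _]addr0 lerD// mulr_natr -sumr_const.
by apply: ler_sum => j jN; apply: xh => //; apply: contraNneq aN => <-.
Qed.

(** Meant for the noises received by [i]: the self-noise vanishes, so only [#|N| - 1] of the [#|N|]
    terms contribute, whence the factor [1 - #|N|^-1]. *)
Lemma mean_hollow_ge N x i l :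
  i \in N -> x i = 0 -> (forall j, j \in N -> j != i -> l <= x j) ->
  (1 - #|N|%:R^-1) * l <= mean N x.
Proof.
move=> iN xi0 lx.
have N0 : (0 : R) < #|N|%:R by rewrite ltr0n card_gt0; apply/set0Pn; exists i.
rewrite /mean -(ler_pM2l N0) !mulrA mulrBr mulr1 !divff ?gt_eqF// mul1r.
rewrite (bigD1 i)//= xi0 add0r.
rewrite -(natr_cardD1 iN) mulr_natl -sumr_const (eq_bigl (fun j => (j \in N) && (j != i))); last first.
  by move=> j; rewrite !inE andbC.
by apply: ler_sum => j /andP[jN ji]; exact: lx.
Qed.

Lemma meanN N x : mean N (fun j => - x j) = - mean N x.
Proof. by rewrite /mean sumrN mulrN. Qed.

Lemma mean_hollow_le N x i h :
  i \in N -> x i = 0 -> (forall j, j \in N -> j != i -> x j <= h) ->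
  mean N x <= (1 - #|N|%:R^-1) * h.
Proof.
move=> iN xi0 xh; rewrite -lerN2 -mulrN -meanN; apply: (@mean_hollow_ge _ _ i) => //.
  by rewrite xi0 oppr0.
by move=> j jN ji; rewrite lerN2 xh.
Qed.

End Averages.

(** * Elementary properties of the projection onto the unit interval *)

Section Projection.
Context {R : realType}.
Implicit Types u l h : R.

Lemma proj01_itv u : 0 <= proj01 u <= 1.
Proof. by rewrite /proj01 le_min ge_min le_max !lexx ler01. Qed.

Lemma proj01_id u : 0 <= u <= 1 -> proj01 u = u.
Proof. by move=> /andP[u0 u1]; rewrite /proj01 max_r// min_r. Qed.

Lemma proj01_ge u l : l <= u -> l <= 1 -> l <= proj01 u.
Proof. by move=> lu l1; rewrite /proj01 le_min le_max l1 lu orbT. Qed.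

Lemma proj01_le u h : u <= h -> 0 <= h -> proj01 u <= h.
Proof. by move=> uh h0; rewrite /proj01 ge_min ge_max uh h0 orbT. Qed.

Lemma proj01_cases (u : R) :
  (u <= 0 /\ proj01 u = 0) \/ (0 <= u <= 1 /\ proj01 u = u) \/ (1 <= u /\ proj01 u = 1).
Proof.
have [u0|u0] := leP u 0.
  by left; split=> //; rewrite /proj01 max_l// min_r// ler01.
have [u1|u1] := leP u 1; first by right; left; rewrite proj01_id ltW.
by right; right; rewrite ltW// /proj01 max_r ?ltW// min_l// ltW.
Qed.

Lemma proj01_lip (u v e : R) : 0 <= e -> u - v <= e -> proj01 u - proj01 v <= e.
Proof.
by move=> *; case: (proj01_cases u) => [[? ->]|[[? ->]|[? ->]]];
  case: (proj01_cases v) => [[? ->]|[[? ->]|[? ->]]]; lra.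
Qed.

End Projection.

(** * One step of the dynamics when the noises are confined to chosen intervals *)

Section Control.
Context {R : realType} {n : nat}.
Variable r : R.
Hypothesis r0 : 0 < r.
Implicit Types (x y : 'I_n -> R) (z : 'I_n -> 'I_n -> R) (C : {set 'I_n}).

Definition in01 x := forall i, 0 <= x i <= 1.

(** The interval depends only on the receiving agent, and only noises along actual edges are
    constrained, since these are the ones that (A2) controls. *)
Definition controlled (lo hi : 'I_n -> R) x z :=
  (forall i, z i i = 0) /\
  (forall i j, j \in nbrs r x i -> j != i -> lo i <= z j i <= hi i).

Definition one_step (lo hi : 'I_n -> R) (S S' : ('I_n -> R) -> Prop) :=
  forall x z, in01 x -> S x -> controlled lo hi x z -> S' (hk_step r x z).

Lemma nbrs_self x i : i \in nbrs r x i.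
Proof. by rewrite inE subrr normr0 ltW. Qed.

Lemma card_nbrs_gt0 x i : (0 < #|nbrs r x i|)%N.
Proof. by rewrite card_gt0; apply/set0Pn; exists i; exact: nbrs_self. Qed.

Lemma card_nbrs_gt1 x i j : j \in nbrs r x i -> j != i -> (1 < #|nbrs r x i|)%N.
Proof.
move=> jN ji; rewrite (cardsD1 i) nbrs_self ltnS card_gt0.
by apply/set0Pn; exists j; rewrite !inE ji; move: jN; rewrite inE.
Qed.

Lemma hk_step_in01 x z : in01 (hk_step r x z).
Proof. by move=> i; exact: proj01_itv. Qed.

Lemma hk_step_noise lo hi x z i : controlled lo hi x z ->
  exists v, hk_step r x z i = proj01 (mean (nbrs r x i) x + v) /\
    (1 - #|nbrs r x i|%:R^-1) * lo i <= v <= (1 - #|nbrs r x i|%:R^-1) * hi i.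
Proof.
move=> [z0 zb]; exists (mean (nbrs r x i) (fun j => z j i)); split.
  by rewrite /hk_step /mean -mulrDr big_split.
apply/andP; split.
  apply: (@mean_hollow_ge _ _ _ _ i) => //; first exact: nbrs_self.
  by move=> j jN ji; have /andP[] := zb _ _ jN ji.
apply: (@mean_hollow_le _ _ _ _ i) => //; first exact: nbrs_self.
by move=> j jN ji; have /andP[] := zb _ _ jN ji.
Qed.

Lemma hk_step_isolated x z i : (forall k, z k k = 0) -> in01 x ->
  (forall j, j != i -> r < `|x j - x i|) -> hk_step r x z i = x i.
Proof.
move=> z0 x01 iso.
have Ni : nbrs r x i = [set i]%SET.
  apply/setP => j; rewrite !inE; have [->|ji] := eqVneq j i.
    by rewrite subrr normr0 ltW.
  by apply/negbTE; rewrite -ltNge iso.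
by rewrite /hk_step Ni cards1 big_set1 z0 addr0 invr1 mul1r proj01_id.
Qed.

Lemma isolatedP x i : #|nbrs r x i| = 1%N \/ (1 < #|nbrs r x i|)%N.
Proof. by have := card_nbrs_gt0 x i; case: #|_| => [|[|m]]//; [left|right]. Qed.

Lemma card1_isolated x i : #|nbrs r x i| = 1%N -> forall j, j != i -> r < `|x j - x i|.
Proof.
move=> N1 j ji; rewrite ltNge; apply/negP => jr.
have : j \in nbrs r x i by rewrite inE.
by move=> /card_nbrs_gt1 /(_ ji); rewrite N1.
Qed.

Lemma half_le_inv_card (N : {set 'I_n}) : (1 < #|N|)%N ->
  2^-1 <= 1 - #|N|%:R^-1 :> R.
Proof.
move=> N1; have : #|N|%:R^-1 <= 2^-1 :> R by rewrite lef_pV2 ?posrE ?ltr0n ?(ltnW N1)// ler_nat.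
lra.
Qed.

Lemma inv_card_itv (N : {set 'I_n}) : (0 < #|N|)%N -> 0 <= (1 - #|N|%:R^-1 : R) <= 1.
Proof.
move=> N1; have : #|N|%:R^-1 <= 1^-1 :> R by rewrite lef_pV2 ?posrE ?ltr0n// ler1n.
rewrite invr1; have : 0 <= #|N|%:R^-1 :> R by rewrite invr_ge0.
lra.
Qed.

(** The averaged noise carries the factor [1 - #|N|^-1], which lies in [[0, 1]] and is at least
    [1/2] as soon as [i] has another neighbour; this turns [c / 2] into [c / 4]. *)
Lemma hk_step_up c x z i : 0 < c -> controlled (fun=> c / 2) (fun=> c) x z ->
  exists v, [/\ hk_step r x z i = proj01 (mean (nbrs r x i) x + v),
    0 <= v <= c & (1 < #|nbrs r x i|)%N -> c / 4 <= v].
Proof.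
move=> c0 /(hk_step_noise i)[v [-> /andP[v1 v2]]]; exists v.
have := inv_card_itv (card_nbrs_gt0 x i); move: v1 v2.
set k := #|_|%:R^-1 => v1 v2 k01; split=> //; first nra.
move=> /half_le_inv_card; rewrite -/k => ?; nra.
Qed.

Lemma hk_step_down c x z i : 0 < c -> controlled (fun=> - c) (fun=> - (c / 2)) x z ->
  exists v, [/\ hk_step r x z i = proj01 (mean (nbrs r x i) x - v),
    0 <= v <= c & (1 < #|nbrs r x i|)%N -> c / 4 <= v].
Proof.
move=> c0 /(hk_step_noise i)[v [-> /andP[v1 v2]]]; exists (- v).
have := inv_card_itv (card_nbrs_gt0 x i); move: v1 v2; rewrite opprK.
set k := #|_|%:R^-1 => v1 v2 k01; split=> //; first nra.
move=> /half_le_inv_card; rewrite -/k => ?; nra.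
Qed.

Definition nonisolated_le (v : R) x :=
  forall i j, j != i -> `|x j - x i| <= r -> x i <= v.

(** A non-isolated agent averages values at most [v] and then loses at least [c / 4]. The delicate
    point is that an isolated agent, possibly far above [v], might become non-isolated: this is
    excluded because the agents below it only move further away. *)
Lemma nonisolated_le_down c v : 0 < c <= r -> 0 <= v ->
  one_step (fun=> - c) (fun=> - (c / 2)) (nonisolated_le v)
    (nonisolated_le (Num.max 0 (v - c / 4))).
Proof.
move=> c0r v0 x z x01 Sx ctl.
have c0 : 0 < c by lra.
set v' := Num.max _ _.
have v'0 : 0 <= v' by rewrite le_max lexx.
have v'v : v - c / 4 <= v' by rewrite le_max lexx orbT.
have memv k l : (1 < #|nbrs r x k|)%N -> l \in nbrs r x k -> x l <= v.
  move=> k1 lk; have [lk'|lk'] := eqVneq l k; last first.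
    by apply: (Sx l k); rewrite 1?eq_sym// distrC; move: lk; rewrite inE.
  rewrite {}lk'; move: k1; rewrite (cardsD1 k) nbrs_self ltnS card_gt0.
  by move=> /set0Pn[m]; rewrite !inE => /andP[mk mr]; exact: (Sx k m).
have moved k : (1 < #|nbrs r x k|)%N -> hk_step r x z k <= v'.
  move=> k1; have [u [-> u0 /(_ k1) u1]] := hk_step_down k c0 ctl.
  apply: proj01_le => //; apply: le_trans v'v.
  have : mean (nbrs r x k) x <= v by apply: mean_le; [exact: card_nbrs_gt0|move=> l; exact: memv].
  lra.
move=> i j ji yr.
have [i1|i1] := isolatedP x i; last exact: moved.
have iso := card1_isolated i1.
have yi : hk_step r x z i = x i by apply: hk_step_isolated => //; case: ctl.
have [j1|j1] := isolatedP x j.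
  have yj : hk_step r x z j = x j.
    by apply: hk_step_isolated => //; [case: ctl|exact: card1_isolated].
  by move: yr; rewrite yi yj leNgt iso.
rewrite yi in yr *.
have := iso _ ji; have [xij|xij] := leP (x i) (x j).
  (* Here [i] is more than [r] below the non-isolated [j], so [x i < v - r], and [r >= c / 4]. *)
  have : x j <= v by apply: memv j1 (nbrs_self _ _).
  rewrite ger0_norm ?subr_ge0//; lra.
rewrite ltr0_norm ?subr_lt0// opprB => rij; exfalso.
have [u [yj u0 /(_ j1) u1]] := hk_step_down j c0 ctl.
(* A neighbour of [j] is at most [x j + r < x i]; since [i] is isolated, it even lies below
   [x i - r]. *)
have : mean (nbrs r x j) x <= x i - r.
  apply: mean_le => [|k kj]; first exact: card_nbrs_gt0.
  move: kj; rewrite inE => kj.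
  have ki : k != i.
    by apply: contraTneq kj => ->; rewrite -ltNge distrC iso.
  have := iso _ ki; move: kj.
  rewrite ler_norml => kj; have [xik|xik] := leP (x i) (x k).
    rewrite ger0_norm ?subr_ge0//; lra.
  rewrite ltr0_norm ?subr_lt0//; lra.
move=> mj; move: yr; rewrite yj ler_norml => /andP[yr _].
have : proj01 (mean (nbrs r x j) x - u) <= Num.max 0 (x i - r - c / 4).
  by apply: proj01_le; rewrite le_max ?lexx//; apply/orP; right; lra.
have := x01 j.
(* Whichever term is the maximum, [j] ends strictly below [x i - r], which is positive because it
   exceeds [x j]; this contradicts [yr]. *)
rewrite /Num.max; case: ltP; lra.
Qed.

End Control.

(** * Existence of neighbours, and growth of a cluster by absorbing isolated agents *)

Section Strategy.
Context {R : realType} {n : nat}.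
Variable r : R.
Hypothesis r0 : 0 < r.
Implicit Types (x y : 'I_n -> R) (z : 'I_n -> 'I_n -> R) (C : {set 'I_n}).

(** Induction on the size, removing the highest agent, which is more than [r] above the one supplied
    by induction. A single agent may sit at [0], so strictness is claimed only for [0 < k]. *)
Lemma spread_points (x : 'I_n -> R) (A : {set 'I_n}) k : in01 x ->
  (forall i j, i \in A -> j \in A -> j != i -> r < `|x j - x i|) ->
  #|A| = k.+1 -> exists2 i, i \in A & k%:R * r <= x i /\ ((0 < k)%N -> k%:R * r < x i).
Proof.
move=> x01; elim: k A => [|k IH] A sep Ak.
  have /set0Pn[i iA] : A != finset.set0 by rewrite -card_gt0 Ak.
  by exists i => //; split=> //; rewrite mul0r; have /andP[] := x01 i.
have /set0Pn[i0 i0A] : A != finset.set0 by rewrite -card_gt0 Ak.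
case: (@arg_maxP _ _ _ i0 (fun i => i \in A) x i0A) => m mA mmax.
have [||i] := IH (A :\ m)%SET.
- by move=> i j; rewrite !inE => /andP[_ iA] /andP[_ jA]; exact: sep.
- by move: Ak; rewrite (cardsD1 m) mA => -[].
rewrite !inE => /andP[im iA] [ki _]; exists m => //.
have : r < `|x m - x i| by apply: sep => //; rewrite eq_sym.
have xim : x i <= x m := mmax _ iA.
rewrite ger0_norm ?subr_ge0// => rm.
rewrite -natr1 mulrDl mul1r; split; lra.
Qed.

(** If all agents were isolated, the highest would exceed [(n - 1) * r >= 1]. Consequently the edge
    set is never empty and (A2) applies at every time. *)
Lemma exists_neighbours x : (1 < n)%N -> (n%:R - 1)^-1 <= r -> in01 x ->
  exists i j, j != i /\ `|x j - x i| <= r.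
Proof.
move=> n1 nr x01; apply: contrapT => H.
have n0 : (0 : R) < n%:R - 1 by rewrite subr_gt0 ltr1n.
have [||i _ [_ ]] := @spread_points x [set: 'I_n]%SET n.-1 x01.
- by move=> i j _ _ ji; rewrite ltNge; apply/negP => ?; apply: H; exists i, j.
- by rewrite cardsT card_ord prednK// ltnW.
rewrite -ltnS prednK ?(ltnW n1)// => /(_ n1).
rewrite -subn1 natrB ?(ltnW n1)//; have := x01 i.
have : 1 <= (n%:R - 1) * r by rewrite -ler_pdivrMl// mulr1.
lra.
Qed.

(** The shape preserved while the cluster rises: a clique lying below all other agents (the second
    difference is signed), each of which is isolated. *)
Definition lower_cluster C x :=
  [/\ forall i j, i \in C -> j \in C -> x i - x j <= r,
      forall i b, i \in C -> b \notin C -> r < x b - x i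
    & forall b b', b \notin C -> b' \notin C -> b != b' -> r < `|x b - x b'|].

Lemma lower_cluster_nbrs C x i : lower_cluster C x -> i \in C -> nbrs r x i = C.
Proof.
move=> [c1 c2 _] iC; apply/setP => j; rewrite inE.
have [jC|jC] := boolP (j \in C).
  by rewrite ler_norml c1// andbT; have := c1 _ _ iC jC; lra.
by apply/negbTE; rewrite -ltNge; have := c2 _ _ iC jC; rewrite ltr_normr => ->.
Qed.

Lemma lower_cluster_isolated C x b :
  lower_cluster C x -> b \notin C -> forall j, j != b -> r < `|x j - x b|.
Proof.
move=> [_ c2 c3] bC j jb; have [jC|jC] := boolP (j \in C); last exact: c3.
by rewrite distrC; have := c2 _ _ jC bC; rewrite ltr_normr => ->.
Qed.

(** The cluster is the set of all non-isolated agents: they all sit at [0], and everyone else is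
    isolated by construction. *)
Lemma nonisolated_le0_cluster x : (exists i j, j != i /\ `|x j - x i| <= r) ->
  in01 x -> nonisolated_le r 0 x ->
  exists C, (2 <= #|C|)%N /\ lower_cluster C x.
Proof.
move=> [i [j [ji xij]]] x01 xle.
pose C := [set k | [exists l, (l != k) && (`|x l - x k| <= r)]]%SET.
have C0 k : k \in C -> x k = 0.
  rewrite inE => /existsP[l /andP[lk lr]]; have := xle _ _ lk lr.
  have := x01 k; lra.
have nC k l : k \notin C -> l != k -> r < `|x l - x k|.
  by rewrite inE => /existsPn /(_ l); rewrite negb_and -ltNge => /orP[/negPn -> //|].
have iC : i \in C by rewrite inE; apply/existsP; exists j; rewrite ji.
have jC : j \in C by rewrite inE; apply/existsP; exists i; rewrite eq_sym ji distrC.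
exists C; split.
  by rewrite (cardsD1 i) iC ltnS card_gt0; apply/set0Pn; exists j; rewrite !inE ji; move: jC; rewrite inE.
split.
- by move=> k l /C0 -> /C0 ->; rewrite subr0 ltW.
- move=> k b kC bC; have kb : k != b by apply: contraNneq bC => <-.
  by have := nC _ _ bC kb; rewrite C0// sub0r normrN subr0 ger0_norm//; have /andP[] := x01 b.
- by move=> b b' _ b'C bb'; exact: nC.
Qed.

(** The moment of contact: some member of the tight group [C] has come within [r] of the outsider
    [a], while others may still be out of its reach. No member has overshot the contact point
    [x a - r] by more than [c]. *)
Definition merging c C a x :=
  [/\ a \notin C, forall i j, i \in C -> j \in C -> x i - x j <= c,
      forall i, i \in C -> x i <= x a - r + c,
      exists2 i, i \in C & x a - x i <= r
    & forall b, b \notin C -> b != a -> r < x b - x a /\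
        forall b', b' \notin C -> b != b' -> r < `|x b - x b'|].

(** All members of [C] average to the same [u], so they land within [[u + c / 4, u + c]], while
    outsiders stay put. Either no outsider is reached and the cluster has risen, or contact is made
    with the lowest outsider. *)
Lemma lower_cluster_up c m v : 0 < c <= r -> (2 <= m < n)%N ->
  one_step r (fun=> c / 2) (fun=> c)
    (fun x => exists C, #|C| = m /\ (lower_cluster C x /\ forall i, i \in C -> v <= x i))
    (fun x => (exists C, #|C| = m /\
                  (lower_cluster C x /\ forall i, i \in C -> v + c / 4 <= x i)) \/
              exists C a, #|C| = m /\ merging c C a x).
Proof.
move=> cr /andP[m2 mn] x z x01 [C [Cm [Cx Cv]]] ctl.
have c0 : 0 < c by lra.
have C0 : (0 < #|C|)%N by rewrite Cm ltnW.
have [b0 b0C] : exists b, b \notin C.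
  apply/existsP; rewrite -negb_forall; apply/negP => /forallP CT.
  by move: mn; rewrite -Cm (_ : C = [set: 'I_n]%SET) ?cardsT ?card_ord ?ltnn//; apply/setP => k; rewrite CT inE.
have [c1 c2 c3] := Cx.
set y := hk_step r x z; set u := mean C x.
have ub b : b \notin C -> u < x b - r.
  move=> bC.
  have /set0Pn[i0 i0C] : C != finset.set0 by rewrite -card_gt0.
  case: (@arg_maxP _ _ _ i0 (fun i => i \in C) x i0C) => k kC kmax.
  have : u <= x k by apply: mean_le.
  have := c2 _ _ kC bC; lra.
have u0 : 0 <= u by apply: mean_ge => // j _; have /andP[] := x01 j.
have uv : v <= u by exact: mean_ge.
have yb b : b \notin C -> y b = x b.
  move=> bC; apply: hk_step_isolated => //; first by case: ctl.
  exact: lower_cluster_isolated bC.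
have yC i : i \in C -> u + c / 4 <= y i <= u + c.
  move=> iC; have [w [yi w0]] := hk_step_up r0 i c0 ctl.
  rewrite (lower_cluster_nbrs Cx iC) Cm => /(_ m2) w1.
  (* The outsider [b0] gives [u + r < 1], so with [c <= r] the projection is inactive. *)
  have := ub _ b0C; have := x01 b0 => ? ?.
  rewrite /y yi (lower_cluster_nbrs Cx iC) -/u proj01_id; lra.
have [[i [a [iC [aC ai]]]]|H] :=
    pselect (exists i a, i \in C /\ (a \notin C /\ x a - y i <= r)).
  right; exists C, a; split=> //; split=> //.
  - by move=> k l kC lC; have := yC _ kC; have := yC _ lC; lra.
  - by move=> k kC; rewrite (yb a)//; have := yC _ kC; have := ub _ aC; lra.
  - by exists i => //; rewrite (yb a).
  (* An outsider [b] more than [r] below [a] would lie below [u + c], against [u < x b - r]; so [a]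
     is the lowest outsider. *)
  - move=> b bC ba; rewrite !yb//; split.
      have := c3 _ _ bC aC ba; have := ub _ bC; have := yC _ iC.
      by rewrite ltr_normr => ? ? /orP[//|]; lra.
    by move=> b' b'C bb'; rewrite !yb//; exact: c3.
left; exists C; split=> //; split; last by move=> i iC; have := yC _ iC; lra.
split.
- by move=> k l kC lC; have := yC _ kC; have := yC _ lC; lra.
- move=> i b iC bC; rewrite (yb b)// ltNge; apply/negP => ?.
  by apply: H; exists i, b.
- by move=> b b' bC b'C bb'; rewrite !yb//; exact: c3.
Qed.

(** Everyone in [a |: C] has at least two neighbours, of which only [a] is far from [q = x a - r],
    so averaging at least halves its excess. The new opinions span at most [3 * c + r / 2], which is
    below [r] since [c <= r / 8]: one step makes a clique. *)
Lemma merging_up c m : 0 < c <= r / 8 -> (2 <= m)%N ->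
  one_step r (fun=> c / 2) (fun=> c)
    (fun x => exists C a, #|C| = m /\ merging c C a x)
    (fun x => exists C, #|C| = m.+1 /\ lower_cluster C x).
Proof.
move=> cr m2 x z x01 [C [a [Cm [aC m1 m3 [i0 i0C ai0] mb]]]] ctl.
have c0 : 0 < c by lra.
exists (a |: C)%SET; split; first by rewrite cardsU1 aC Cm.
set y := hk_step r x z.
set q := x a - r.
have outC b : b \notin (a |: C)%SET -> b \notin C /\ b != a.
  by rewrite !inE negb_or => /andP[].
have farb k b : k \in (a |: C)%SET -> b \notin (a |: C)%SET -> r < x b - x k.
  move=> + /outC[bC ba]; have [ab _] := mb _ bC ba.
  rewrite !inE => /orP[/eqP->//|kC].
  by have := m3 _ kC; lra.
have yb b : b \notin (a |: C)%SET -> y b = x b.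
  move=> bC; apply: hk_step_isolated => //; first by case: ctl.
  move=> j jb; have [jC|jC] := boolP (j \in (a |: C)%SET).
    by have := farb _ _ jC bC; rewrite distrC ltr_normr => ->.
  have [bC' ba] := outC _ bC; have [jC' ja] := outC _ jC.
  by have [_ ->] := mb _ jC' ja.
have xC j : j \in C -> q - c <= x j <= q + c.
  by move=> jC; have := m1 _ _ i0C jC; have := m3 _ jC; rewrite /q; lra.
have Nsub k j : k \in (a |: C)%SET -> j \in nbrs r x k -> j \in (a |: C)%SET.
  move=> kC; rewrite inE => jk; apply/negPn/negP => jC.
  by move: jk; rewrite leNgt; have := farb _ _ kC jC; rewrite ltr_normr => ->.
(* [a] sees [i0], and a member of [C] sees all of [C], which has at least two elements. *)
have N1 k : k \in (a |: C)%SET -> (1 < #|nbrs r x k|)%N.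
  rewrite !inE => /orP[/eqP->|kC].
    apply: (@card_nbrs_gt1 _ _ _ r0 _ _ i0).
      rewrite inE ler_norml; have := m3 _ i0C; lra.
    by apply: contraNneq aC => <-.
  apply: (@leq_trans #|C|); first by rewrite Cm.
  apply: subset_leq_card; apply/fintype.subsetP => j jC.
  by rewrite inE ler_norml; have := m1 _ _ kC jC; have := m1 _ _ jC kC; lra.
have yC k : k \in (a |: C)%SET -> q - c <= y k <= q + 2 * c + r / 2.
  move=> kC; have [w [yk w0 _]] := hk_step_up r0 k c0 ctl.
  have lo : q - c <= mean (nbrs r x k) x.
    apply: mean_ge => [|j /(Nsub _ _ kC)]; first exact: card_nbrs_gt0.
    by rewrite !inE => /orP[/eqP->|/xC]; rewrite /q; lra.
  (* The outlier is [a], whose excess over [q + c] is exactly [r - c]. *)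
  have hi : mean (nbrs r x k) x <= (q + c) + (r - c) / 2.
    apply: (@mean_le_one_outlier _ _ _ _ a); first exact: N1.
    - lra.
    - by move=> j /(Nsub _ _ kC); rewrite !inE => /orP[/eqP->|/xC]; [rewrite eqxx|lra].
    - by rewrite /q; lra.
  have := x01 i0; have := xC _ i0C; have := x01 a => xa xi0 x0.
  rewrite /y yk; apply/andP; split.
    by apply: proj01_ge; rewrite /q in lo *; lra.
  by apply: proj01_le; lra.
split.
- by move=> i j /yC yi /yC; lra.
- move=> i b /yC yi bC; rewrite (yb b)//.
  have [bC' ba] := outC _ bC; have [] := mb _ bC' ba; rewrite /q in yi; lra.
- move=> b b' bC b'C bb'; rewrite !yb//.
  by have [bC' ba] := outC _ bC; have [b'C' _] := outC _ b'C; have [_ ->] := mb _ bC' ba.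
Qed.

End Strategy.

(** * Moves of a group of mutual neighbours: descent, ascent, spreading and splitting; the
    diameter *)

Section Consensus.
Context {R : realType} {n : nat}.
Variable r : R.
Hypothesis r0 : 0 < r.
Implicit Types (x y : 'I_n -> R) (z : 'I_n -> 'I_n -> R).

Definition pairwise_le (c : R) x := forall i j, x i - x j <= c.

Lemma pairwise_le_nbrs x i : pairwise_le r x -> nbrs r x i = [set: 'I_n]%SET.
Proof.
move=> xr; apply/setP => j; rewrite !inE ler_norml xr andbT.
by have := xr i j; lra.
Qed.

Lemma pairwise_le_up c x z i : (1 < n)%N -> 0 < c -> pairwise_le r x ->
  controlled r (fun=> c / 2) (fun=> c) x z ->
  exists2 v, hk_step r x z i = proj01 (mean [set: 'I_n]%SET x + v) & c / 4 <= v <= c.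
Proof.
move=> n1 c0 xr /(hk_step_up r0 i c0)[v [yi v0]].
rewrite pairwise_le_nbrs// in yi *; rewrite cardsT card_ord => /(_ n1) v1.
by exists v => //; rewrite v1; case/andP: v0.
Qed.

(** All agents start from the same average, so new differences come from the noises alone; the
    projection, being 1-Lipschitz, does not enlarge them. *)
Lemma pairwise_le_down c v : (1 < n)%N -> 0 < c <= r -> 0 <= v ->
  one_step r (fun=> - c) (fun=> - (c / 2))
    (fun x => pairwise_le r x /\ forall i, x i <= v)
    (fun x : 'I_n -> R => pairwise_le r x /\ forall i, x i <= Num.max 0 (v - c / 4)).
Proof.
move=> n1 cr v0 x z x01 [xr xv] ctl; have c0 : 0 < c by lra.
have n0 : (0 < #|[set: 'I_n]%SET|)%N by rewrite cardsT card_ord ltnW.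
have uv : mean [set: 'I_n]%SET x <= v by exact: mean_le.
have step i : exists2 w, hk_step r x z i = proj01 (mean [set: 'I_n]%SET x - w) & c / 4 <= w <= c.
  have [w [yi w0]] := hk_step_down r0 i c0 ctl.
  rewrite pairwise_le_nbrs// in yi *; rewrite cardsT card_ord => /(_ n1) w1.
  by exists w => //; rewrite w1; case/andP: w0.
split=> [i j|i].
  have [wi -> ?] := step i; have [wj -> ?] := step j.
  by apply: proj01_lip; lra.
have [w -> ?] := step i; apply: proj01_le; last by rewrite le_max lexx.
by rewrite le_max; apply/orP; right; lra.
Qed.

(** One agent below [l] keeps the average below [l + c], so the group cannot jump over [h] in one
    step and is not truncated at [1]. *)
Lemma pairwise_le_rise c l h v : (1 < n)%N -> 0 < c <= r -> l + 2 * c <= h -> h <= 1 ->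
  one_step r (fun=> c / 2) (fun=> c)
    (fun x : 'I_n -> R => (pairwise_le c x /\ forall i, v <= x i <= h) /\ exists i, x i < l)
    (fun x : 'I_n -> R => pairwise_le c x /\ forall i, v + c / 4 <= x i <= h).
Proof.
move=> n1 cr lh h1 x z x01 [[xc xv] [k xk]] ctl; have c0 : 0 < c by lra.
have n0 : (0 < #|[set: 'I_n]%SET|)%N by rewrite cardsT card_ord ltnW.
have xr : pairwise_le r x by move=> i j; have := xc i j; lra.
have vu : v <= mean [set: 'I_n]%SET x by apply: mean_ge => // i _; have /andP[] := xv i.
have u0 : 0 <= mean [set: 'I_n]%SET x by apply: mean_ge => // i _; have /andP[] := x01 i.
have ul : mean [set: 'I_n]%SET x <= l + c.
  by apply: mean_le => // i _; have := xc i k; lra.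
have step i := pairwise_le_up i n1 c0 xr ctl.
split=> [i j|i].
  have [wi -> ?] := step i; have [wj -> ?] := step j.
  by apply: proj01_lip; lra.
by have [w -> ?] := step i; rewrite proj01_id; lra.
Qed.

(** With a common average, two agents differ at most by the difference of two averaged noises, each
    of absolute value at most [(1 - n^-1) * eta]. *)
Lemma pairwise_le_bounded eta : 0 <= eta ->
  one_step r (fun=> - eta) (fun=> eta) (pairwise_le r)
    (pairwise_le (2 * ((1 - n%:R^-1) * eta)) : ('I_n -> R) -> Prop).
Proof.
move=> eta0 x z x01 xr ctl i j.
have n0 : (0 < #|[set: 'I_n]%SET|)%N by rewrite cardsT card_ord (leq_ltn_trans _ (ltn_ord i)).
have := inv_card_itv (R := R) n0; rewrite cardsT card_ord => k01.
have [v [-> ]] := hk_step_noise r0 i ctl; have [w [-> ]] := hk_step_noise r0 j ctl.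
rewrite !pairwise_le_nbrs// cardsT card_ord => ? ?.
by apply: proj01_lip; nra.
Qed.

(** Agent [i0] receives almost maximal noises and [i1] almost minimal ones. The margin
    [(1 - n^-1) * eta] from both ends of the unit interval keeps the projection inactive for these
    two, and each loses at most [e]. *)
Lemma spread_step eta e (i0 i1 : 'I_n) : i0 != i1 -> 0 < e <= eta ->
  one_step r (fun i => if i == i0 then eta - e else - eta)
             (fun i => if i == i0 then eta else - eta + e)
    (fun x => pairwise_le r x /\
       forall i, (1 - n%:R^-1) * eta <= x i <= 1 - (1 - n%:R^-1) * eta)
    (fun x => 2 * ((1 - n%:R^-1) * eta) - 2 * e <= x i0 - x i1).
Proof.
move=> i01 e0 x z x01 [xr xd] ctl.
have n0 : (0 < #|[set: 'I_n]%SET|)%N by rewrite cardsT card_ord (leq_ltn_trans _ (ltn_ord i0)).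
have := inv_card_itv (R := R) n0; rewrite cardsT card_ord => k01.
have u0 : (1 - n%:R^-1) * eta <= mean [set: 'I_n]%SET x.
  by apply: mean_ge => // i _; have /andP[] := xd i.
have u1 : mean [set: 'I_n]%SET x <= 1 - (1 - n%:R^-1) * eta.
  by apply: mean_le => // i _; have /andP[] := xd i.
have [v [yi0 ]] := hk_step_noise r0 i0 ctl; have [w [yi1 ]] := hk_step_noise r0 i1 ctl.
rewrite !pairwise_le_nbrs// cardsT card_ord eqxx [i1 == i0]eq_sym (negbTE i01) in yi0 yi1 * => hw hv.
move: u0 u1 k01 hv hw; set k := 1 - n%:R^-1 => u0 u1 k01.
rewrite !mulrBr !mulrDr !mulrN => hv hw.
have ? : k * e <= k * eta by rewrite ler_wpM2l; lra.
have ? : k * e <= e by rewrite ler_piMl; lra.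
rewrite yi0 yi1 !proj01_id; lra.
Qed.

Definition split_off (i0 : 'I_n) v x :=
  [/\ x i0 = 0, forall i, i != i0 -> r < x i, forall i, i != i0 -> v <= x i
    & forall i j, i != i0 -> j != i0 -> x i - x j <= r].

(** Write [delta] for [(1 - n^-1) * eta]. From an average in [[r / 2, r / 2 + e]], agent [i0] is
    sent below [r / 2 + 2 * e - delta <= 0] and projected to [0]; the others reach at least
    [r / 2 + delta - e > r], or are projected to [1 > r]. *)
Lemma split_step eta e (i0 : 'I_n) : r < 1 -> 0 < e <= r / 2 ->
  r / 2 + 2 * e <= (1 - n%:R^-1) * eta ->
  one_step r (fun i => if i == i0 then - eta else eta - e)
             (fun i => if i == i0 then - eta + e else eta)
    (fun x => forall i, r / 2 <= x i <= r / 2 + e) (split_off i0 0).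
Proof.
move=> r1 e0 ed x z x01 xd ctl.
have n0 : (0 < #|[set: 'I_n]%SET|)%N by rewrite cardsT card_ord (leq_ltn_trans _ (ltn_ord i0)).
have := inv_card_itv (R := R) n0; rewrite cardsT card_ord => k01.
have xr : pairwise_le r x by move=> i j; have := xd i; have := xd j; lra.
have u0 : r / 2 <= mean [set: 'I_n]%SET x.
  by apply: mean_ge => // i _; have /andP[] := xd i.
have u1 : mean [set: 'I_n]%SET x <= r / 2 + e.
  by apply: mean_le => // i _; have /andP[] := xd i.
have stp i : i != i0 -> exists2 v, hk_step r x z i = proj01 (mean [set: 'I_n]%SET x + v) &
    (1 - n%:R^-1) * eta - e <= v <= (1 - n%:R^-1) * eta.
  move=> ii0; have [v [-> ]] := hk_step_noise r0 i ctl.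
  rewrite !pairwise_le_nbrs// cardsT card_ord (negbTE ii0) => hv.
  by exists v => //; nra.
split.
- have [v [-> ]] := hk_step_noise r0 i0 ctl.
  rewrite !pairwise_le_nbrs// cardsT card_ord eqxx => hv.
  by case: (proj01_cases (mean [set: 'I_n]%SET x + v)) => [[? ->//]|[[? ->]|[? ->]]]; nra.
- move=> i /stp[v -> ?].
  by case: (proj01_cases (mean [set: 'I_n]%SET x + v)) => [[? ->//]|[[? ->]|[? ->]]]; lra.
- by move=> i _; have /andP[] := hk_step_in01 r x z i.
- by move=> i j /stp[v -> ?] /stp[w -> ?]; apply: proj01_lip; lra.
Qed.

(** Agent [i0] is isolated, hence frozen at [0]. The remaining agents form a clique of at least two
    because [2 < n], so they do receive noise and rise together. *)
Lemma split_off_up c v (i0 : 'I_n) : (2 < n)%N -> 0 < c <= r -> v <= 1 -> r < 1 ->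
  one_step r (fun=> c / 2) (fun=> c) (split_off i0 v) (split_off i0 (Num.min 1 (v + c / 4))).
Proof.
move=> n2 cr v1 r1 x z x01 [x0 xr xv xx] ctl; have c0 : 0 < c by lra.
have iso j : j != i0 -> r < `|x j - x i0|.
  by move=> /xr; rewrite x0 subr0 ltr_normr => ->.
have Ni i : i != i0 -> nbrs r x i = [set~ i0]%SET.
  move=> ii0; apply/setP => j; rewrite !inE; have [->|ji0] /= := eqVneq j i0.
    by apply/negbTE; rewrite -ltNge distrC iso.
  by rewrite ler_norml xx// andbT; have := xx _ _ ii0 ji0; lra.
have N2 : (1 < #|[set~ i0]%SET : {set 'I_n}|)%N.
  by rewrite cardsC1 card_ord -ltnS prednK// (ltn_trans _ n2).
have ur : r < mean [set~ i0]%SET x.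
  have /set0Pn[i1 i1C] : ([set~ i0] : {set 'I_n})%SET != finset.set0 by rewrite -card_gt0 ltnW.
  case: (@arg_minP _ _ _ i1 (fun i => i \in [set~ i0]%SET) x i1C) => k kC kmin.
  have : x k <= mean [set~ i0]%SET x by apply: mean_ge => //; exact: ltnW.
  by apply: lt_le_trans; apply: xr; move: kC; rewrite !inE.
have uv : v <= mean [set~ i0]%SET x.
  by apply: mean_ge => [|j]; [exact: ltnW|rewrite !inE; exact: xv].
have stp i : i != i0 -> exists2 w, hk_step r x z i = proj01 (mean [set~ i0]%SET x + w) &
    c / 4 <= w <= c.
  move=> ii0; have [w [yi w0]] := hk_step_up r0 i c0 ctl.
  rewrite Ni// in yi * => /(_ N2) w1.
  by exists w => //; rewrite w1; case/andP: w0.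
split.
- by rewrite -x0; apply: hk_step_isolated => //; case: ctl.
- move=> i /stp[w -> ?].
  by case: (proj01_cases (mean [set~ i0]%SET x + w)) => [[? ->//]|[[? ->]|[? ->]]]; lra.
- move=> i /stp[w -> ?]; apply: proj01_ge; last by rewrite ge_min lexx.
  by rewrite ge_min; apply/orP; right; lra.
- by move=> i j /stp[w -> ?] /stp[w' -> ?]; apply: proj01_lip; lra.
Qed.

Lemma le_diam x i j : `|x i - x j| <= diam x.
Proof.
by apply: le_trans (le_bigmax _ _ i); exact: (le_bigmax _ (fun j => `|x i - x j|) j).
Qed.

(** The maxima in [diam] start from [0], whence the condition on [c]; exchanging [i] and [j]
    recovers the absolute value. *)
Lemma diam_leP x c : 0 <= c -> (forall i j, x i - x j <= c) <-> diam x <= c.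
Proof.
move=> c0; split=> [xc|xc i j]; last first.
  by apply: le_trans xc; apply: le_trans (le_diam x i j); exact: ler_norm.
apply/bigmax_leP; split=> // i _; apply/bigmax_leP; split=> // j _.
by rewrite ler_norml xc andbT; have := xc j i; lra.
Qed.

Lemma diam_ge0 x : 0 <= diam x.
Proof. exact: bigmax_ge_id. Qed.

Lemma diam_ltP x c : diam x < c <-> 0 < c /\ forall i j, x i - x j < c.
Proof.
split=> [xc|[c0 xc]].
  split=> [|i j]; first by apply: le_lt_trans xc; exact: diam_ge0.
  by apply: le_lt_trans xc; apply: le_trans (le_diam x i j); exact: ler_norm.
apply/bigmax_ltP; split=> // i _; apply/bigmax_ltP; split=> // j _.
by rewrite ltr_norml xc andbT; have := xc j i; lra.
Qed.

End Consensus.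

(** * Probabilities as real numbers *)

Section RealProbability.
Context {R : realType} (d : measure_display) (T : measurableType d) (P : probability T R).

Definition pr (A : set T) : R := fine (P A).

Lemma prE (A : set T) : measurable A -> P A = (pr A)%:E.
Proof. by move=> mA; rewrite fineK// fin_num_measure. Qed.

Lemma pr_ge0 (A : set T) : 0 <= pr A.
Proof. exact: fine_ge0. Qed.

Lemma pr_le (A B : set T) : measurable A -> measurable B -> A `<=` B -> pr A <= pr B.
Proof.
by move=> mA mB AB; rewrite -lee_fin -!prE// le_measure// ?inE.
Qed.

Lemma pr_le1 (A : set T) : measurable A -> pr A <= 1.
Proof. by move=> mA; rewrite -lee_fin -prE// probability_le1. Qed.

Lemma prU (A B : set T) : measurable A -> measurable B -> A `&` B = set0 ->
  pr (A `|` B) = pr A + pr B.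
Proof.
move=> mA mB AB; apply: EFin_inj; rewrite EFinD -!prE//; last exact: measurableU.
exact: measureU.
Qed.

(** Total probability over finitely many cases: an inequality valid on each fiber of [f] is summed
    over a duplicate-free list of values. *)
Lemma ler_pr_fibers (I : finType) (f : T -> I) (p : R) (B B' : set T) :
  measurable B -> measurable B' -> (forall i, measurable [set w | f w = i]) ->
  (forall i, p * pr (B `&` [set w | f w = i]) <= pr (B' `&` [set w | f w = i])) ->
  p * pr B <= pr B'.
Proof.
move=> mB mB' mf le.
have mfs (s : seq I) : measurable [set w | f w \in s].
  elim: s => [|i s IH]; first by rewrite (_ : [set _ | _] = set0)//; apply/seteqP; split.
  rewrite (_ : [set _ | _] = [set w | f w = i] `|` [set w | f w \in s]); first exact: measurableU.
  by apply/seteqP; split=> w /=; rewrite inE => /predU1P.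
suff H (s : seq I) : uniq s ->
    p * pr (B `&` [set w | f w \in s]) <= pr (B' `&` [set w | f w \in s]).
  have := H (enum I) (enum_uniq _).
  rewrite (_ : [set w | f w \in enum I] = setT) ?setIT//.
  by apply/seteqP; split=> w //= _; rewrite mem_enum.
elim: s => [_|i s IH /= /andP[is_ us]].
  rewrite (_ : [set w | f w \in [::]] = set0) ?setI0; last by apply/seteqP; split.
  by rewrite /pr measure0 mulr0.
have split_fiber (A : set T) : measurable A -> pr (A `&` [set w | f w \in i :: s]) =
    pr (A `&` [set w | f w = i]) + pr (A `&` [set w | f w \in s]).
  move=> mA; rewrite -prU.
  - congr pr; rewrite -setIUr; congr setI.
    by apply/seteqP; split=> w /=; rewrite inE => /predU1P.
  - exact: measurableI.
  - exact: measurableI.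
  - by apply/seteqP; split=> // w [[_ /= fw] [_ /=]]; rewrite fw (negbTE is_).
by rewrite !split_fiber// mulrDr lerD// IH.
Qed.

Lemma pr_setD (A B : set T) : measurable A -> measurable B ->
  pr (A `\` B) = pr A - pr (A `&` B).
Proof.
move=> mA mB; apply/eqP; rewrite eq_sym subr_eq; apply/eqP.
rewrite -prU.
- by rewrite setUC setUIDK.
- exact: measurableD.
- exact: measurableI.
- by apply/seteqP; split=> // w [[_ nB] [_]].
Qed.

End RealProbability.

(** * Measurability of predicates on opinion vectors *)

Section MeasurablePredicates.
Context {R : realType} {n : nat}.
Implicit Types S : ('I_n -> R) -> Prop.

(** Quantifying over all measurable spaces lets the same fact serve for the ambient sigma-algebra
    and for that of the history up to a given time. *)
Definition mpred S := forall (d : measure_display) (T : measurableType d) (f : T -> 'I_n -> R),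
  (forall i, measurable_fun setT (fun w => f w i)) -> measurable [set w | S (f w)].

Lemma mpred_ext S S' : (forall x, S x <-> S' x) -> mpred S -> mpred S'.
Proof. by move=> SS'; have -> : S = S' by apply/funext => x; apply/propext. Qed.

Lemma mpred_const (Q : Prop) : mpred (fun=> Q).
Proof.
move=> d T f _; have [q|q] := pselect Q.
  by rewrite (_ : [set _ | _] = setT)//; apply/seteqP; split.
by rewrite (_ : [set _ | _] = set0)//; apply/seteqP; split.
Qed.

Lemma mpred_and S S' : mpred S -> mpred S' -> mpred (fun x => S x /\ S' x).
Proof. by move=> mS mS' d T f mf; apply: measurableI; [exact: mS|exact: mS']. Qed.

Lemma mpred_or S S' : mpred S -> mpred S' -> mpred (fun x => S x \/ S' x).
Proof. by move=> mS mS' d T f mf; apply: measurableU; [exact: mS|exact: mS']. Qed.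

Lemma mpred_not S : mpred S -> mpred (fun x => ~ S x).
Proof. by move=> mS d T f mf; apply: measurableC; exact: mS. Qed.

Lemma mpred_imp S S' : mpred S -> mpred S' -> mpred (fun x => S x -> S' x).
Proof.
move=> mS mS'; apply: (@mpred_ext (fun x => ~ S x \/ S' x)).
  by move=> x; split=> [[]//|SS']; have [/SS'|] := pselect (S x); [right|left].
by apply: mpred_or => //; exact: mpred_not.
Qed.

Lemma mpred_forall (I : finType) (S : I -> ('I_n -> R) -> Prop) :
  (forall i, mpred (S i)) -> mpred (fun x => forall i, S i x).
Proof.
move=> mS d T f mf.
rewrite (_ : [set _ | _] = \bigcap_(i in [set: I]) [set w | S i (f w)]); last first.
  by apply/seteqP; split=> w /= Sw i *; exact: Sw.
by apply: fin_bigcap_measurable => // i _; exact: mS.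
Qed.

Lemma mpred_exists (I : finType) (S : I -> ('I_n -> R) -> Prop) :
  (forall i, mpred (S i)) -> mpred (fun x => exists i, S i x).
Proof.
move=> mS; apply: (@mpred_ext (fun x => ~ forall i, ~ S i x)).
  by move=> x; split=> [/existsNP[i /contrapT ?]|[i Si] /(_ i)//]; exists i.
by apply: mpred_not; apply: mpred_forall => i; exact: mpred_not.
Qed.

Lemma mpred_and3 S1 S2 S3 : mpred S1 -> mpred S2 -> mpred S3 ->
  mpred (fun x => [/\ S1 x, S2 x & S3 x]).
Proof.
move=> m1 m2 m3; apply: (mpred_ext _ (mpred_and m1 (mpred_and m2 m3))).
by move=> x; split=> [[? []]|[]].
Qed.

Lemma mpred_and4 S1 S2 S3 S4 : mpred S1 -> mpred S2 -> mpred S3 -> mpred S4 ->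
  mpred (fun x => [/\ S1 x, S2 x, S3 x & S4 x]).
Proof.
move=> m1 m2 m3 m4; apply: (mpred_ext _ (mpred_and m1 (mpred_and3 m2 m3 m4))).
by move=> x; split=> [[? []]|[]].
Qed.

Lemma mpred_and5 S1 S2 S3 S4 S5 :
  mpred S1 -> mpred S2 -> mpred S3 -> mpred S4 -> mpred S5 ->
  mpred (fun x => [/\ S1 x, S2 x, S3 x, S4 x & S5 x]).
Proof.
move=> m1 m2 m3 m4 m5; apply: (mpred_ext _ (mpred_and m1 (mpred_and4 m2 m3 m4 m5))).
by move=> x; split=> [[? []]|[]].
Qed.

Lemma mpred_andb (b b' : ('I_n -> R) -> bool) : mpred b -> mpred b' ->
  mpred (fun x => b x && b' x).
Proof.
move=> m1 m2; apply: (mpred_ext _ (mpred_and m1 m2)).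
by move=> x; split=> [[-> ->]|/andP].
Qed.

Lemma mpred_exists2 (I : finType) (S S' : I -> ('I_n -> R) -> Prop) :
  (forall i, mpred (S i)) -> (forall i, mpred (S' i)) ->
  mpred (fun x => exists2 i, S i x & S' i x).
Proof.
move=> mS mS'; apply: (mpred_ext _ (mpred_exists (fun i => mpred_and (mS i) (mS' i)))).
by move=> x; split=> [[i []]|[i]]; exists i.
Qed.

Definition mreal (g : ('I_n -> R) -> R) :=
  forall (d : measure_display) (T : measurableType d) (f : T -> 'I_n -> R),
  (forall i, measurable_fun setT (fun w => f w i)) -> measurable_fun setT (fun w => g (f w)).

Lemma mreal_coord i : mreal (fun x => x i).
Proof. by move=> d T f mf; exact: mf. Qed.

Lemma mreal_const c : mreal (fun=> c).
Proof. by move=> d T f mf; exact: measurable_cst. Qed.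

Lemma mreal_sub g g' : mreal g -> mreal g' -> mreal (fun x => g x - g' x).
Proof. by move=> mg mg' d T f mf; apply: measurable_funB; [exact: mg|exact: mg']. Qed.

Lemma mreal_add g g' : mreal g -> mreal g' -> mreal (fun x => g x + g' x).
Proof. by move=> mg mg' d T f mf; apply: measurable_funD; [exact: mg|exact: mg']. Qed.

Lemma mreal_norm g : mreal g -> mreal (fun x => `|g x|).
Proof. by move=> mg d T f mf; apply: measurableT_comp; [exact: normr_measurable|exact: mg]. Qed.

Lemma mpred_le g g' : mreal g -> mreal g' -> mpred (fun x => g x <= g' x).
Proof.
move=> mg mg' d T f mf; rewrite -[X in measurable X]setTI.
by apply: measurable_fun_le => //; [exact: mg|exact: mg'].
Qed.

Lemma mpred_lt g g' : mreal g -> mreal g' -> mpred (fun x => g x < g' x).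
Proof.
move=> mg mg'; apply: (@mpred_ext (fun x => ~ g' x <= g x)).
  by move=> x; rewrite ltNge; split => /negP.
by apply: mpred_not; exact: mpred_le.
Qed.

Lemma mpred_eq g g' : mreal g -> mreal g' -> mpred (fun x => g x = g' x).
Proof.
move=> mg mg'; apply: (mpred_ext _ (mpred_and (mpred_le mg mg') (mpred_le mg' mg))).
by move=> x; split=> [[? ?]|->]; [apply/eqP; rewrite eq_le; apply/andP|].
Qed.

Lemma mpred_diam_le c : mpred (fun x => diam x <= c).
Proof.
have [c0|c0] := leP 0 c; last first.
  apply: (@mpred_ext (fun=> False)); last exact: mpred_const.
  by move=> x; split=> // xc; have := le_lt_trans (le_trans (diam_ge0 x) xc) c0; rewrite ltxx.
apply: (@mpred_ext (fun x => forall i j, x i - x j <= c)); first by move=> x; exact: diam_leP.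
apply: mpred_forall => i; apply: mpred_forall => j; apply: mpred_le; last exact: mreal_const.
by apply: mreal_sub; exact: mreal_coord.
Qed.

Lemma mpred_diam_ge c : mpred (fun x => c <= diam x).
Proof.
apply: (@mpred_ext (fun x => ~ (0 < c /\ forall i j, x i - x j < c))).
  move=> x; split=> [xc|xc /diam_ltP]; last by rewrite ltNge xc.
  by rewrite leNgt; apply/negP => /diam_ltP.
apply: mpred_not; apply: mpred_and; first exact: mpred_const.
apply: mpred_forall => i; apply: mpred_forall => j; apply: mpred_lt; last exact: mreal_const.
by apply: mreal_sub; exact: mreal_coord.
Qed.

End MeasurablePredicates.

Ltac measurable_predicate :=
  repeat first
    [ apply: mpred_le | apply: mpred_lt | apply: mpred_eq
    | apply: mreal_coord | apply: mreal_const | apply: mreal_sub | apply: mreal_add | apply: mreal_norm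
    | apply: mpred_const | apply: mpred_andb | apply: mpred_and
    | apply: mpred_and3 | apply: mpred_and4 | apply: mpred_and5 | apply: mpred_exists2 => ? | apply: mpred_or | apply: mpred_not
    | apply: mpred_forall => ? | apply: mpred_exists => ? | apply: mpred_imp ].

(** The neighbour set takes finitely many values; the step is written as a finite sum over them of a
    measurable function switched on by the event that this set occurs. *)
Lemma measurable_hk_step (R : realType) (n : nat) (r : R) (d : measure_display)
    (T : measurableType d) (X : T -> 'I_n -> R) (Z : T -> 'I_n -> 'I_n -> R) i :
  (forall i, measurable_fun setT (fun w => X w i)) ->
  (forall j i, measurable_fun setT (fun w => Z w j i)) ->
  measurable_fun setT (fun w => hk_step r (X w) (Z w) i).
Proof.
move=> mX mZ.
pose g (N : {set 'I_n}) w := proj01 (#|N|%:R^-1 * \sum_(j in N) (X w j + Z w j i)).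
have mg N : measurable_fun setT (g N).
  rewrite /g /proj01; apply: measurable_minr; first exact: measurable_cst.
  apply: measurable_maxr; first exact: measurable_cst.
  apply: measurable_funM; first exact: measurable_cst.
  rewrite (_ : (fun _ => _) = (fun w => \sum_(j <- enum N) (X w j + Z w j i))); last first.
    by apply/funext => w; rewrite big_enum.
  by apply: measurable_sum => j; exact: measurable_funD.
rewrite (_ : (fun _ => _) = (fun w => \sum_(N <- enum {set 'I_n})
    (if nbrs r (X w) i == N then g N w else 0))); last first.
  apply/funext => w; rewrite big_enum/= (bigD1 (nbrs r (X w) i))//= eqxx big1 ?addr0//.
  by move=> N /negbTE; rewrite eq_sym => ->.
apply: measurable_sum => N; apply: measurable_fun_ifT => //.
apply: (measurable_fun_bool true); rewrite setTI.
suff : mpred (fun x => nbrs r x i = N).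
  move=> /(_ _ _ _ mX); congr measurable; apply/seteqP; split=> w /= /eqP//.
apply: (@mpred_ext _ _ (fun x => forall j, (`|x j - x i| <= r) = (j \in N))).
  move=> x; split=> [xN|<- j]; last by rewrite inE.
  by apply/setP => j; rewrite inE xN.
apply: mpred_forall => j; have [jN|jN] := boolP (j \in N); last apply: (@mpred_ext _ _ (fun x => ~ (`|x j - x i| <= r))).
- by measurable_predicate.
- by move=> x; split=> [/negP/negbTE//|->].
- by measurable_predicate.
Qed.

(** * From one-step control to conditional hitting probabilities *)

Section Model.
Context (R : realType) (n : nat) (r eta rho : R).
Context (d : measure_display) (T : measurableType d) (P : probability T R).
Context (zeta : nat -> 'I_n -> 'I_n -> T -> R) (x0 : 'I_n -> R).
Hypotheses (zeta_ok : noise_ok eta zeta) (x0_01 : in01 x0).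
Hypothesis A2 : assumption_A2 P r eta rho x0 zeta.

Local Notation X := (hk_traj r x0 zeta).
Local Notation hist := (hist_events r x0 zeta).

Lemma measurable_traj t i : measurable_fun setT (fun w => X t w i).
Proof.
elim: t i => [|t IH] i /=; first exact: measurable_cst.
by apply: measurable_hk_step => // j k; case: zeta_ok.
Qed.

Lemma traj_in01 t w : in01 (X t w).
Proof. by case: t => [//|t]; exact: hk_step_in01. Qed.

Definition hist_gen (t : nat) : set (set T) :=
  [set A | exists s i (B : set R), (s <= t)%N /\ measurable B /\
        A = (fun w => X s w i) @^-1` B].

(** The space [T] equipped with the history up to [t], at which [mpred] and the closure properties
    of sigma-algebras can be instantiated. *)
Definition hist_type t := g_sigma_algebraType (hist_gen t).

Lemma hist_measurable t A : hist t A -> measurable A.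
Proof.
apply: smallest_sub; first exact: sigma_algebra_measurable.
move=> _ [s [i [B [_ [mB ->]]]]].
by rewrite -[X in measurable X]setTI; exact: measurable_traj.
Qed.

Lemma hist_le s t A : (s <= t)%N -> hist s A -> hist t A.
Proof.
move=> st; apply: sub_sigma_algebra2 => _ [u [i [B [us [mB ->]]]]].
by exists u, i, B; split=> //; exact: leq_trans st.
Qed.

Lemma hist_mpred S s t : (s <= t)%N -> mpred S -> hist t [set w | S (X s w)].
Proof.
move=> st mS; apply: (mS _ (hist_type t) (X s)) => i _ B mB.
by rewrite setTI; apply: sub_sigma_algebra; exists s, i, B.
Qed.

Lemma hist_setI t A B : hist t A -> hist t B -> hist t (A `&` B).
Proof. exact: (@measurableI _ (hist_type t)). Qed.

Lemma hist_setD t A B : hist t A -> hist t B -> hist t (A `\` B).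
Proof. exact: (@measurableD _ (hist_type t)). Qed.

Lemma hist_bigcup t (F : nat -> set T) :
  (forall k, hist t (F k)) -> hist t (\bigcup_k F k).
Proof. exact: (@bigcupT_measurable _ (hist_type t)). Qed.

Lemma hist_const t (Q : Prop) : hist t [set w | Q].
Proof. by apply: (@hist_mpred (fun=> Q) t t) => //; exact: mpred_const. Qed.

Lemma measurable_pred S t : mpred S -> measurable [set w | S (X t w)].
Proof. by move=> mS; apply: hist_measurable; exact: (@hist_mpred S t t). Qed.

Definition hits S t L : set T := [set w | exists u, (t <= u <= t + L)%N /\ S (X u w)].

Lemma hist_hits S t L u : mpred S -> (t + L <= u)%N -> hist u (hits S t L).
Proof.
move=> mS tLu; rewrite (_ : hits _ _ _ =
    \bigcup_s ([set w | (t <= s <= t + L)%N] `&` [set w | S (X s w)])); last first.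
  by apply/seteqP; split=> w [s]; [move=> [? ?]; exists s|move=> _ [? ?]; exists s].
apply: hist_bigcup => s; have [stL|stL] := boolP (t <= s <= t + L)%N.
  apply: hist_setI; first exact: hist_const.
  by apply: hist_mpred => //; case/andP: stL => _ /leq_trans; exact.
rewrite (_ : _ `&` _ = [set w | False]); first exact: hist_const.
by apply/seteqP; split=> w []//; rewrite (negbTE stL).
Qed.

(** A lower bound on a conditional probability given the past, expressed by testing against every
    history event [A]. *)
Definition reaches (L : nat) (p : R) (S S' : ('I_n -> R) -> Prop) :=
  forall t A, hist t A ->
    p * pr P (A `&` [set w | S (X t w)]) <=
    pr P (A `&` [set w | S (X t w)] `&` hits S' t L).

Hypotheses (r0 : 0 < r) (n1 : (1 < n)%N) (nr : (n%:R - 1)^-1 <= r) (rho0 : 0 < rho).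

(** A product over all pairs, with factors capped at [1], bounds from below the product over any
    edge set; the result therefore does not depend on the state. *)
Definition step_prob (lo hi : 'I_n -> R) : R :=
  Num.min 1 (rho * \prod_(e : 'I_n * 'I_n) Num.min 1 (hi e.1 - lo e.1)).

Lemma mpred_edges E : mpred (fun x : 'I_n -> R => edges r x = E).
Proof.
apply: (@mpred_ext _ _ (fun x => forall e : 'I_n * 'I_n,
    (`|x e.2 - x e.1| <= r) && (e.2 != e.1) <-> e \in E)).
  move=> x; split=> [xE|<- e]; last by rewrite !inE.
  by apply/setP => e; rewrite !inE; apply/idP/idP => /xE.
apply: mpred_forall => e; apply: (@mpred_ext _ _ (fun x =>
    ((`|x e.2 - x e.1| <= r /\ e.2 != e.1) -> e \in E) /\
    (e \in E -> (`|x e.2 - x e.1| <= r /\ e.2 != e.1)))).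
  by move=> x; split=> [[a b]|[a b]]; split=> [/andP|]; eauto; move=> /b/andP.
by measurable_predicate.
Qed.

(** The event is cut according to the current edge set, and (A2) is applied on each piece to the box
    given by [lo] and [hi]; inside that box the step is controlled. *)
Lemma step_reaches lo hi S S' : mpred S -> mpred S' ->
  (forall i, [/\ - eta <= lo i, lo i < hi i & hi i <= eta]) ->
  one_step r lo hi S S' -> reaches 1 (step_prob lo hi) S S'.
Proof.
move=> mS mS' box SS' t A hA.
have mA := hist_measurable hA.
have mAS : measurable (A `&` [set w | S (X t w)]).
  by apply: measurableI => //; exact: measurable_pred.
have mH : measurable (hits S' t 1) by apply: hist_measurable; exact: (@hist_hits _ _ _ (t + 1)).
have mE E : measurable [set w | edges r (X t w) = E].
  by apply: (@measurable_pred (fun x => edges r x = E)); exact: mpred_edges.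
apply: (@ler_pr_fibers _ _ _ P _ (fun w => edges r (X t w))) => //.
  exact: measurableI.
move=> E; have [E0|E0] := eqVneq E finset.set0.
  (* (A2) says nothing for an empty edge set, but this piece is empty since two neighbours always
     exist. *)
  rewrite (_ : _ `&` [set w | _ = E] = set0); first by rewrite /pr measure0 mulr0 fine_ge0.
  apply/seteqP; split=> // w [_ /=]; rewrite E0.
  have [i [j [ji ij]]] := exists_neighbours n1 nr (traj_in01 t w).
  by move=> /setP /(_ (i, j)); rewrite !inE/= ji ij.
have := @A2 t E (fun e => lo e.1) (fun e => hi e.1) _
  (hist_setI hA (hist_mpred (leqnn t) mS)) E0.
set box_event := [set w | forall e, e \in E -> _].
have mbox : measurable box_event.
  rewrite (_ : box_event = \bigcap_(e in [set: 'I_n * 'I_n])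
      [set w | e \in E -> lo e.1 <= zeta t e.2 e.1 w <= hi e.1]); last first.
    by apply/seteqP; split=> w /= Hw e *; exact: Hw.
  apply: fin_bigcap_measurable => // e _; have [eE|eE] := boolP (e \in E); last first.
    by rewrite (_ : [set _ | _] = setT)//; apply/seteqP; split.
  rewrite (_ : [set _ | _] = (fun w => zeta t e.2 e.1 w) @^-1` `[lo e.1, hi e.1]); last first.
    apply/seteqP; split=> w /=; rewrite in_itv/=; first exact.
    by move=> ? _.
  by rewrite -[X in measurable X]setTI; case: zeta_ok => + _; apply.
have le_box : pr P (A `&` [set w | S (X t w)] `&` [set w | edges r (X t w) = E] `&` box_event) <=
    pr P (A `&` [set w | S (X t w)] `&` hits S' t 1 `&` [set w | edges r (X t w) = E]).
  apply: pr_le.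
  - by apply: measurableI => //; exact: measurableI.
  - by apply: measurableI => //; exact: measurableI.
  - move=> w [[[Aw Sw] Ew] bw]; split=> //; split=> //.
    exists t.+1; split; first by rewrite leqnSn addn1 leqnn.
    apply: SS' => //; first exact: traj_in01.
    split; first by move=> i; case: zeta_ok => _ [].
    by move=> i j jN ji; apply: (bw (i, j)); rewrite -Ew inE/= jN.
move=> A2'; apply: le_trans le_box; move: A2'.
rewrite (prE P); last exact: measurableI.
rewrite (prE P); last by apply: measurableI => //; exact: measurableI.
rewrite -EFinM lee_fin => A2'.
apply: le_trans (A2' _) => [|e _]; last by have [] := box e.1.
rewrite ler_wpM2r ?pr_ge0// /step_prob ge_min; apply/orP; right.
rewrite ler_pM2l// [leRHS]big_mkcond/=.
apply: ler_prod => e _; have [_ lh _] := box e.1.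
rewrite le_min ler01 subr_ge0 ltW//=; case: ifP => _; rewrite ge_min lexx ?orbT//.
Qed.

Lemma refl_reaches S : mpred S -> reaches 0 1 S S.
Proof.
move=> mS t A hA; rewrite mul1r pr_le//.
- by apply: measurableI; [exact: hist_measurable hA|exact: measurable_pred].
- apply: measurableI; last by apply: hist_measurable; exact: (@hist_hits _ _ _ (t + 0)).
  by apply: measurableI; [exact: hist_measurable hA|exact: measurable_pred].
- by move=> w [Aw Sw]; split=> //; exists t; rewrite addn0 leqnn.
Qed.

Lemma ler_pr_cases p (B B' : set T) S t : mpred S -> measurable B -> measurable B' ->
  p * pr P (B `&` [set w | S (X t w)]) <= pr P (B' `&` [set w | S (X t w)]) ->
  p * pr P (B `&` [set w | ~ S (X t w)]) <= pr P (B' `&` [set w | ~ S (X t w)]) ->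
  p * pr P B <= pr P B'.
Proof.
move=> mS mB mB' leT leF.
have fT : [set w | `[< S (X t w) >] = true] = [set w | S (X t w)].
  by apply/seteqP; split=> w /asboolP.
have fF : [set w | `[< S (X t w) >] = false] = [set w | ~ S (X t w)].
  by apply/seteqP; split=> w /= => [fF Sw|/asboolF//]; rewrite asboolT in fF.
apply: (@ler_pr_fibers _ _ _ P _ (fun w => `[< S (X t w) >])) => //.
  by case; rewrite ?fT ?fF; [exact: measurable_pred|apply: measurableC; exact: measurable_pred].
by case; rewrite ?fT ?fF.
Qed.

(** A first-entrance argument by induction on [k]: where [S] holds at time [t], apply [reaches]
    there; elsewhere its failure is a history event that joins [A], and the search resumes at
    [t.+1]. Thus [reaches] works from a random time of entering [S]. *)
Lemma hits_reaches L p S S' : mpred S -> mpred S' -> reaches L p S S' ->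
  forall k t A, hist t A ->
    p * pr P (A `&` hits S t k) <= pr P (A `&` hits S' t (k + L)).
Proof.
move=> mS mS' rS; elim=> [|k IH] t A hA.
  have := rS t A hA; rewrite (_ : hits S t 0 = [set w | S (X t w)]); last first.
    apply/seteqP; split=> w; last by exists t; rewrite addn0 leqnn.
    by move=> [u [+ Su]]; rewrite addn0 -eqn_leq => /eqP ->.
  move=> /le_trans; apply; rewrite add0n; apply: pr_le.
  - apply: measurableI; last by apply: hist_measurable; exact: (@hist_hits _ _ _ (t + L)).
    by apply: measurableI; [exact: hist_measurable hA|exact: measurable_pred].
  - apply: measurableI; last by apply: hist_measurable; exact: (@hist_hits _ _ _ (t + L)).
    exact: hist_measurable hA.
  - by move=> w [[]].
have mA := hist_measurable hA.
have mh Q u l : mpred Q -> measurable (hits Q u l).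
  by move=> mQ; apply: hist_measurable; exact: (@hist_hits _ _ _ (u + l)).
apply: (@ler_pr_cases _ _ _ S t) => //.
- by apply: measurableI => //; exact: mh.
- by apply: measurableI => //; exact: mh.
- rewrite (_ : _ `&` _ `&` _ = A `&` [set w | S (X t w)]); last first.
    apply/seteqP; split=> w [] => [[]//|Aw Sw]; split=> //; split=> //.
    by exists t; rewrite leqnn leq_addr.
  apply: le_trans (rS t A hA) _; apply: pr_le.
  + by apply: measurableI; [apply: measurableI => //; exact: measurable_pred|exact: mh].
  + by apply: measurableI; [apply: measurableI => //; exact: mh|exact: measurable_pred].
  + move=> w [[Aw Sw] [u [/andP[tu uL] S'u]]]; split=> //; split=> //; exists u; split=> //.
    by rewrite tu (leq_trans uL)// leq_add2l leq_addl.
- have hA' : hist t.+1 (A `&` [set w | ~ S (X t w)]).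
    apply: (hist_le (leqnSn t)); apply: hist_setI => //.
    by apply: (@hist_mpred (fun x => ~ S x)) => //; exact: mpred_not.
  rewrite (_ : A `&` hits S t k.+1 `&` _ = A `&` [set w | ~ S (X t w)] `&` hits S t.+1 k); last first.
    apply/seteqP; split=> w.
      move=> [[Aw [u [/andP[tu uk] Su]]] nS]; split=> //; exists u; split=> //.
      rewrite addSnnS uk andbT ltn_neqAle tu andbT.
      by apply: contra_notN nS => /eqP ->.
    move=> [[Aw nS] [u [/andP[tu uk] Su]]]; split=> //; split=> //; exists u; split=> //.
    by rewrite (ltnW tu) -addSnnS.
  apply: le_trans (IH _ _ hA') _; apply: pr_le.
  + by apply: measurableI; [exact: hist_measurable hA'|exact: mh].
  + apply: measurableI; first by apply: measurableI => //; exact: mh.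
    by apply: measurableC; exact: measurable_pred.
  + move=> w [[Aw nS] [u [/andP[tu uk] Su]]]; split=> //; split=> //; exists u; split=> //.
    by rewrite (ltnW tu) addSn -addSnnS addSn.
Qed.

Lemma trans_reaches L1 L2 p1 p2 S1 S2 S3 :
  mpred S1 -> mpred S2 -> mpred S3 -> 0 <= p2 ->
  reaches L1 p1 S1 S2 -> reaches L2 p2 S2 S3 -> reaches (L1 + L2) (p1 * p2) S1 S3.
Proof.
move=> m1 m2 m3 p20 r1 r2 t A hA; rewrite mulrAC mulrC.
apply: le_trans (ler_wpM2l p20 (r1 t A hA)) _.
by apply: hits_reaches => //; apply: hist_setI => //; exact: hist_mpred.
Qed.

Lemma weaken_reaches L L' p p' S S' : mpred S -> mpred S' ->
  (L <= L')%N -> p' <= p -> reaches L p S S' -> reaches L' p' S S'.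
Proof.
move=> mS mS' LL pp rS t A hA.
apply: le_trans (ler_wpM2r (pr_ge0 _ _) pp) _.
have mAS : measurable (A `&` [set w | S (X t w)]).
  by apply: measurableI; [exact: hist_measurable hA|exact: measurable_pred].
apply: le_trans (rS t A hA) _; apply: pr_le.
- by apply: measurableI => //; apply: hist_measurable; exact: (@hist_hits _ _ _ (t + L)).
- by apply: measurableI => //; apply: hist_measurable; exact: (@hist_hits _ _ _ (t + L')).
- move=> w [? [u [/andP[tu uL] S'u]]]; split=> //; exists u; split=> //.
  by rewrite tu (leq_trans uL)// leq_add2l.
Qed.

Lemma union_reaches L p S1 S2 S' : mpred S1 -> mpred S2 -> mpred S' ->
  reaches L p S1 S' -> reaches L p S2 S' -> reaches L p (fun x => S1 x \/ S2 x) S'.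
Proof.
move=> m1 m2 mS' r1 r2 t A hA.
have mA := hist_measurable hA.
have mh : measurable (hits S' t L) by apply: hist_measurable; exact: (@hist_hits _ _ _ (t + L)).
have m12 : measurable [set w | S1 (X t w) \/ S2 (X t w)].
  by apply: (@measurable_pred (fun x => S1 x \/ S2 x)); exact: mpred_or.
apply: (@ler_pr_cases _ _ _ S1 t) => //.
- exact: measurableI.
- by apply: measurableI => //; exact: measurableI.
- rewrite (_ : A `&` _ `&` _ = A `&` [set w | S1 (X t w)]); last first.
    by apply/seteqP; split=> w /=; tauto.
  rewrite (_ : A `&` _ `&` _ `&` _ = A `&` [set w | S1 (X t w)] `&` hits S' t L); first exact: r1.
  by apply/seteqP; split=> w /=; tauto.
- have hA' : hist t (A `&` [set w | ~ S1 (X t w)]).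
    by apply: hist_setI => //; apply: (@hist_mpred (fun x => ~ S1 x)) => //; exact: mpred_not.
  rewrite (_ : A `&` _ `&` _ = A `&` [set w | ~ S1 (X t w)] `&` [set w | S2 (X t w)]); last first.
    by apply/seteqP; split=> w /=; tauto.
  rewrite (_ : A `&` _ `&` _ `&` _ =
      A `&` [set w | ~ S1 (X t w)] `&` [set w | S2 (X t w)] `&` hits S' t L); first exact: r2.
  by apply/seteqP; split=> w /=; tauto.
Qed.

End Model.

(** * Reachability with uniform constants, and the steering strategy *)

Section Reachability.
Context (R : realType) (n : nat) (r eta rho : R).
Hypotheses (n3 : (3 <= n)%N) (nr : (n%:R - 1)^-1 <= r) (r1 : r < 1).
Hypotheses (eta0 : 0 < eta) (rho0 : 0 < rho).

Let n1 : (1 < n)%N. Proof. exact: ltn_trans n3. Qed.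

Let r0 : 0 < r.
Proof. by apply: lt_le_trans nr; rewrite invr_gt0 subr_gt0 ltr1n. Qed.

(** The constants [L] and [p] are chosen before the probability space, the noises and the initial
    state; this yields the uniformity asked of the final rate. *)
Definition reach (S S' : ('I_n -> R) -> Prop) :=
  [/\ mpred S, mpred S' & exists (L : nat) (p : R), 0 < p <= 1 /\
    forall (d : measure_display) (T : measurableType d) (P : probability T R)
      (zeta : nat -> 'I_n -> 'I_n -> T -> R) (x0 : 'I_n -> R),
      noise_ok eta zeta -> assumption_A2 P r eta rho x0 zeta -> in01 x0 ->
      reaches r P zeta x0 L p S S'].

Lemma reach_step lo hi S S' : mpred S -> mpred S' ->
  (forall i, [/\ - eta <= lo i, lo i < hi i & hi i <= eta]) ->
  one_step r lo hi S S' -> reach S S'.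
Proof.
move=> mS mS' box SS'; split=> //; exists 1%N, (step_prob rho lo hi); split.
  rewrite /step_prob ge_min lexx lt_min ltr01/= !andbT mulr_gt0//.
  apply: prodr_gt0 => e _; rewrite lt_min ltr01 subr_gt0.
  by have [] := box e.1.
by move=> d T P zeta x0 zok A2 x01; apply: (step_reaches zok x01 A2) => //.
Qed.

Lemma reach_sub S S' : mpred S -> mpred S' ->
  (forall x, in01 x -> S x -> S' x) -> reach S S'.
Proof.
move=> mS mS' SS'; split=> //; exists 0%N, 1; split; first by rewrite ltr01 lexx.
move=> d T P zeta x0 zok A2 x01 t A hA; have := refl_reaches P zok mS hA.
move=> /le_trans; apply; apply: pr_le.
- apply: measurableI; last by apply: (hist_measurable zok); exact: (@hist_hits _ _ _ _ _ _ _ _ _ _ (t + 0)).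
  by apply: measurableI; [exact: (hist_measurable zok hA)|exact: (measurable_pred _ _ zok)].
- apply: measurableI; last by apply: (hist_measurable zok); exact: (@hist_hits _ _ _ _ _ _ _ _ _ _ (t + 0)).
  by apply: measurableI; [exact: (hist_measurable zok hA)|exact: (measurable_pred _ _ zok)].
- move=> w [ASw [u [tu Su]]]; split=> //; exists u; split=> //.
  by apply: SS' => //; exact: traj_in01.
Qed.

Lemma reach_trans S1 S2 S3 : reach S1 S2 -> reach S2 S3 -> reach S1 S3.
Proof.
move=> [m1 m2 [L1 [p1 [p10 r12]]]] [_ m3 [L2 [p2 [p20 r23]]]]; split=> //.
exists (L1 + L2)%N, (p1 * p2); split; first by apply/andP; split; nra.
move=> d T P zeta x0 zok A2 x01; apply: (trans_reaches zok (S2 := S2)) => //.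
- by have /andP[/ltW] := p20.
- exact: r12.
- exact: r23.
Qed.

Lemma reach_or S1 S2 S' : reach S1 S' -> reach S2 S' -> reach (fun x => S1 x \/ S2 x) S'.
Proof.
move=> [m1 m' [L1 [p1 [p10 r1']]]] [m2 _ [L2 [p2 [p20 r2]]]]; split=> //.
  exact: mpred_or.
exists (maxn L1 L2), (Num.min p1 p2); split.
  by rewrite lt_min ge_min; lra.
move=> d T P zeta x0 zok A2 x01; apply: (union_reaches zok) => //.
- by apply: (weaken_reaches zok m1 m' _ _ (r1' _ _ _ _ _ zok A2 x01)); rewrite ?leq_maxl// ge_min lexx.
- by apply: (weaken_reaches zok m2 m' _ _ (r2 _ _ _ _ _ zok A2 x01)); rewrite ?leq_maxr// ge_min lexx orbT.
Qed.

(** Each stage either advances or succeeds. In the uses below, stage [N] contradicts the opinions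
    being at most [1], so success occurs within [N] stages. *)
Lemma reach_loop (S : nat -> ('I_n -> R) -> Prop) S' N :
  (forall k, reach (S k) (fun x => S k.+1 x \/ S' x)) -> reach (S N) S' -> reach (S 0%N) S'.
Proof.
move=> step; elim: N => [//|N IH] SN; apply: IH; apply: (reach_trans (step N)).
have [_ mS' _] := SN.
by apply: reach_or => //; exact: (reach_sub mS' mS' (fun _ _ => id)).
Qed.

Lemma maxr0_iter (a e : R) : 0 <= e -> Num.max 0 (Num.max 0 a - e) = Num.max 0 (a - e).
Proof.
move=> e0; have [a0|a0] := leP 0 a => //.
by rewrite sub0r !max_l//; lra.
Qed.

Lemma exists_natM_gt1 (e : R) : 0 < e -> exists N, 1 < N%:R * e.
Proof.
move=> e0; exists (Num.truncn e^-1).+1.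
by rewrite -ltr_pdivrMr// div1r truncnS_gt.
Qed.

Lemma reach_descend (Q : R -> ('I_n -> R) -> Prop) lo hi e : 0 < e ->
  (forall v, mpred (Q v)) ->
  (forall i, [/\ - eta <= lo i, lo i < hi i & hi i <= eta]) ->
  (forall v, 0 <= v -> one_step r lo hi (Q v) (Q (Num.max 0 (v - e)))) ->
  reach (Q 1) (Q 0).
Proof.
move=> e0 mQ box step.
have H k : reach (Q 1) (Q (Num.max 0 (1 - k%:R * e))).
  elim: k => [|k IH]; first by rewrite mul0r subr0 max_r//; exact: reach_sub.
  apply: (reach_trans IH); apply: (reach_step (lo := lo) (hi := hi)) => //.
  rewrite -(natr1 k) mulrDl mul1r opprD addrA -(maxr0_iter _ (ltW e0)).
  by apply: step; rewrite le_max lexx.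
have [N N1] := exists_natM_gt1 e0.
by have := H N; rewrite max_l//; lra.
Qed.

(** The common push: small enough to be an admissible noise and to satisfy the bound of
    [merging_up]. *)
Let c := Num.min eta (r / 8).
Let c0 : 0 < c. Proof. by rewrite /c lt_min eta0/= divr_gt0. Qed.

Let bounds : [/\ 0 < r < 1, 0 < eta, 0 < c, c <= eta & c <= r / 8].
Proof. by rewrite r0 r1; split=> //; rewrite /c ge_min lexx ?orbT. Qed.

Definition cluster_ge m (x : 'I_n -> R) :=
  exists C : {set 'I_n}, (m <= #|C|)%N /\ lower_cluster r C x.

Lemma mpred_cluster_ge m : mpred (cluster_ge m).
Proof. by rewrite /cluster_ge /lower_cluster; measurable_predicate. Qed.

(** A cluster of exactly [m] agents gains [c / 4] in height per step until contact; as heights are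
    bounded by [1], contact comes in bounded time. A larger cluster needs no move. *)
Lemma reach_merge m : (2 <= m < n)%N -> reach (cluster_ge m) (cluster_ge m.+1).
Proof.
have [? ? ? ? ?] := bounds.
move=> mn; have m2 : (2 <= m)%N by case/andP: mn.
pose S k (x : 'I_n -> R) := exists C : {set 'I_n}, #|C| = m /\
  (lower_cluster r C x /\ forall i, i \in C -> k%:R * (c / 4) <= x i).
pose M (x : 'I_n -> R) := exists (C : {set 'I_n}) (a : 'I_n), #|C| = m /\ merging r c C a x.
have mS k : mpred (S k) by rewrite /S /lower_cluster; measurable_predicate.
have mM : mpred M by rewrite /M /merging; measurable_predicate.
have mc k : mpred (cluster_ge k) by exact: mpred_cluster_ge.
have box (i : 'I_n) : [/\ - eta <= c / 2, c / 2 < c & c <= eta] by split; lra.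
have rM : reach M (cluster_ge m.+1).
  apply: (reach_step (lo := fun=> c / 2) (hi := fun=> c)) => //.
  move=> x z x01 Mx ctl; have cr : 0 < c <= r / 8 by rewrite c0.
  have [C [Cm Cx]] := merging_up r0 cr m2 x01 Mx ctl.
  by exists C; rewrite Cm.
have rS k : reach (S k) (fun x => S k.+1 x \/ cluster_ge m.+1 x).
  apply: (@reach_trans _ (fun x => S k.+1 x \/ M x)).
    apply: (reach_step (lo := fun=> c / 2) (hi := fun=> c)) => //; first exact: mpred_or.
    rewrite /S -(natr1 k) mulrDl mul1r; apply: lower_cluster_up => //.
    by rewrite c0/=; lra.
  apply: reach_or.
    by apply: reach_sub => //; [exact: mpred_or|left].
  apply: (reach_trans rM); apply: reach_sub => //; [exact: mpred_or|by right].
have [N N1] : exists N, 1 < N%:R * (c / 4) by apply: exists_natM_gt1; lra.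
have rS' : reach (S 0%N) (cluster_ge m.+1).
  apply: (@reach_loop S _ N) => //; apply: reach_sub => // x x01 [C [Cm [_ Cx]]].
  have /set0Pn[i iC] : C != finset.set0 by rewrite -card_gt0 Cm ltnW.
  by have := Cx i iC; have := x01 i; lra.
have := reach_or rS' (reach_sub (mc m.+1) (mc m.+1) (fun _ _ => id)).
apply: reach_trans; apply: reach_sub => //; first exact: mpred_or.
move=> x x01 [C [Cm Cx]]; move: Cm; rewrite leq_eqVlt => /predU1P[Cm|Cm]; last by right; exists C.
by left; exists C; split=> //; split=> // i _; rewrite mul0r; have /andP[] := x01 i.
Qed.

Definition at_zero (x : 'I_n -> R) := forall i, x i <= 0.

Lemma mpred_at_zero : mpred at_zero.
Proof. by rewrite /at_zero; measurable_predicate. Qed.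

Lemma reach_zero : reach (fun=> True) at_zero.
Proof.
have [? ? ? ? ?] := bounds.
have mni v : mpred (nonisolated_le r v : ('I_n -> R) -> Prop).
  by rewrite /nonisolated_le; measurable_predicate.
have box (i : 'I_n) : [/\ - eta <= - c, - c < - (c / 2) & - (c / 2) <= eta] by split; lra.
have cr : 0 < c <= r by rewrite c0; lra.
have c4 : 0 < c / 4 by lra.
apply: (@reach_trans _ (nonisolated_le r 1)).
  apply: reach_sub => //; first exact: mpred_const.
  by move=> x x01 _ i j _ _; have /andP[] := x01 i.
apply: (@reach_trans _ (nonisolated_le r 0)).
  apply: (reach_descend (lo := fun=> - c) (hi := fun=> - (c / 2)) c4) => // v v0.
  exact: nonisolated_le_down.
apply: (@reach_trans _ (cluster_ge 2)).
  apply: reach_sub => //; first exact: mpred_cluster_ge.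
  move=> x x01 xle; apply: nonisolated_le0_cluster => //.
  exact: exists_neighbours.
apply: (@reach_trans _ (cluster_ge n)).
  have H k : (k.+2 <= n)%N -> reach (cluster_ge 2) (cluster_ge k.+2).
    elim: k => [_|k IH kn]; first by apply: reach_sub => //; exact: mpred_cluster_ge.
    by apply: (reach_trans (IH (ltnW kn))); exact: reach_merge.
  by have := H n.-2; rewrite prednK -?subn1 ?subn_gt0// subn1 prednK ?(ltnW n1)//; apply.
pose Q (v : R) (x : 'I_n -> R) := pairwise_le r x /\ forall i, x i <= v.
have mQ v : mpred (Q v) by rewrite /Q /pairwise_le; measurable_predicate.
apply: (@reach_trans _ (Q 1)).
  apply: reach_sub => //; first exact: mpred_cluster_ge.
  move=> x x01 [C [nC [Cr _ _]]].
  have CT i : i \in C.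
    have : C = [set: 'I_n]%SET by apply/eqP; rewrite eqEcard finset.subsetT cardsT card_ord.
    by move=> ->; rewrite inE.
  by split=> [i j|i]; [exact: Cr|have /andP[] := x01 i].
apply: (@reach_trans _ (Q 0)).
  apply: (reach_descend (lo := fun=> - c) (hi := fun=> - (c / 2)) c4) => // v v0.
  exact: pairwise_le_down.
by apply: reach_sub => //; [exact: mpred_at_zero|move=> x _ []].
Qed.

(** The group climbs with pushes [e <= (h - l) / 2], too small to jump over the target, and stops as
    soon as nobody is below [l]. *)
Lemma reach_interval l h : 0 <= l -> l < h -> h <= 1 ->
  reach at_zero (fun x => pairwise_le r x /\ forall i, l <= x i <= h).
Proof.
have [? ? ? ? ?] := bounds.
move=> l0 lh h1; pose e := Num.min c ((h - l) / 2).
have e0 : 0 < e by rewrite /e lt_min c0/=; lra.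
have ec : e <= c by rewrite /e ge_min lexx.
have elh : e <= (h - l) / 2 by rewrite /e ge_min lexx orbT.
pose S k (x : 'I_n -> R) := pairwise_le e x /\ forall i, k%:R * (e / 4) <= x i <= h.
set S' := fun x => _.
have mS k : mpred (S k) by rewrite /S /pairwise_le; measurable_predicate.
have mS' : mpred S' by rewrite /S' /pairwise_le; measurable_predicate.
have mSl k : mpred (fun x => S k x /\ exists i, x i < l).
  by apply: mpred_and => //; measurable_predicate.
have box (i : 'I_n) : [/\ - eta <= e / 2, e / 2 < e & e <= eta] by split; lra.
have rS k : reach (S k) (fun x => S k.+1 x \/ S' x).
  apply: (@reach_trans _ (fun x => (S k x /\ exists i, x i < l) \/ S' x)).
    apply: reach_sub => //; first exact: mpred_or.
    move=> x x01 [Sx1 Sx2].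
    have [|nl] := pselect (exists i, x i < l); first by left.
    right; split; first by move=> i j; have := Sx1 i j; lra.
    move=> i; have /andP[_ ->] := Sx2 i; rewrite andbT leNgt.
    by apply/negP => xi; apply: nl; exists i.
  apply: reach_or.
    apply: (@reach_trans _ (S k.+1)); last by apply: reach_sub => //; [exact: mpred_or|left].
    apply: (reach_step (lo := fun=> e / 2) (hi := fun=> e)) => //.
    rewrite /S -(natr1 k) mulrDl mul1r; apply: pairwise_le_rise => //; first by rewrite e0/=; lra.
    lra.
  by apply: reach_sub => //; [exact: mpred_or|right].
have [N N1] : exists N, 1 < N%:R * (e / 4) by apply: exists_natM_gt1; lra.
apply: (@reach_trans _ (S 0%N)).
  apply: reach_sub => //; first exact: mpred_at_zero.
  move=> x x01 x0; split=> [i j|i]; first by have := x01 j; have := x0 i; lra.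
  by rewrite mul0r; have := x01 i; have := x0 i; lra.
apply: (@reach_loop S _ N) => //; apply: reach_sub => // x x01 [_ Sx].
by have := Sx (Ordinal n1); have := x01 (Ordinal n1); lra.
Qed.

Let i0 : 'I_n := Ordinal (ltnW n1).
Let i1 : 'I_n := Ordinal n1.

(** The group is first raised to [[dd, 1 - dd]], a nondegenerate interval because [2 * dd <= r < 1],
    and then spread in one step. *)
Lemma reach_spread alpha : 0 < alpha -> 2 * ((1 - n%:R^-1) * eta) <= r ->
  reach at_zero (fun x => 2 * ((1 - n%:R^-1) * eta) - alpha <= diam x).
Proof.
have [? ? ? ? ?] := bounds.
move=> alpha0 dr; pose e := Num.min eta (alpha / 2).
have e0 : 0 < e by rewrite /e lt_min eta0/=; lra.
have eeta : e <= eta by rewrite /e ge_min lexx.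
have ealpha : e <= alpha / 2 by rewrite /e ge_min lexx orbT.
have k01 : 0 <= (1 - n%:R^-1 : R).
  by rewrite subr_ge0 invf_le1 ?ltr0n ?ler1n ltnW.
set dd := (1 - _) * eta in dr *.
have dd0 : 0 <= dd by rewrite mulr_ge0// ltW.
apply: (@reach_trans _ (fun x => pairwise_le r x /\ forall i, dd <= x i <= 1 - dd)).
  by apply: reach_interval; lra.
apply: (@reach_trans _ (fun x => 2 * dd - 2 * e <= x i0 - x i1)).
  apply: (reach_step (lo := fun i => if i == i0 then eta - e else - eta)
                     (hi := fun i => if i == i0 then eta else - eta + e)).
  - by rewrite /pairwise_le; measurable_predicate.
  - by measurable_predicate.
  - by move=> i; case: ifP => _; split; lra.
  - by apply: spread_step => //; rewrite e0.
apply: reach_sub; [by measurable_predicate|exact: mpred_diam_ge|].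
move=> x x01 xe; have := le_diam x i0 i1; have := ler_norm (x i0 - x i1); lra.
Qed.

Lemma reach_one : r < 2 * ((1 - n%:R^-1) * eta) ->
  reach at_zero (fun x => 1 <= diam x).
Proof.
have [? ? ? ? ?] := bounds.
set dd := (1 - _) * eta => rd.
(* The third bound gives [r / 2 + 2 * e <= dd], as [split_step] requires; the fourth keeps the
   target interval below [1]. *)
pose e := Num.min (Num.min eta (r / 2)) (Num.min ((dd - r / 2) / 2) ((1 - r / 2) / 2)).
have e0 : 0 < e by rewrite /e !lt_min eta0/=; lra.
have ele : [/\ e <= eta, e <= r / 2, e <= (dd - r / 2) / 2 & e <= (1 - r / 2) / 2].
  by rewrite /e; split; rewrite !ge_min lexx ?orbT.
have [e1 e2 e3 e4] := ele.
have mso v : mpred (split_off r i0 v) by rewrite /split_off; measurable_predicate.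
pose I x := pairwise_le r x /\ forall i : 'I_n, r / 2 <= x i <= r / 2 + e.
apply: (@reach_trans _ I); first by apply: reach_interval; lra.
apply: (@reach_trans _ (split_off r i0 0)).
  apply: (reach_step (lo := fun i => if i == i0 then - eta else eta - e)
                     (hi := fun i => if i == i0 then - eta + e else eta)) => //.
  - by rewrite /I /pairwise_le; measurable_predicate.
  - by move=> i; case: ifP => _; split; lra.
  - move=> x z x01 [_ Ix]; apply: split_step => //; [by rewrite e0|].
    by rewrite -/dd; lra.
apply: (@reach_trans _ (split_off r i0 1)).
  (* The ascent to [1] is a descent of the deficit [1 - v] from [1] to [0]. *)
  rewrite -[X in split_off r i0 X](subrr 1) -[X in reach _ (split_off r i0 X)](subr0 1).
  apply: (@reach_descend (fun v => split_off r i0 (1 - v)) (fun=> c / 2) (fun=> c) (c / 4)) => //.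
  - lra.
  - by move=> i; split; lra.
  - move=> v v0; rewrite (_ : 1 - Num.max 0 (v - c / 4) = Num.min 1 (1 - v + c / 4)).
      by apply: split_off_up => //; rewrite ?c0/=; lra.
    by have [?|?] := leP 0 (v - c / 4); [rewrite min_r|rewrite min_l]; lra.
apply: reach_sub => //; first exact: mpred_diam_ge.
move=> x x01 [x0 _ x1 _]; have := le_diam x i1 i0.
by have := ler_norm (x i1 - x i0); have := x1 i1 isT; rewrite x0; lra.
Qed.

End Reachability.

(** * Repeated attempts over time windows, and the stopping times *)

Section Recurrence.
Context (R : realType) (n : nat) (r eta : R).
Context (d : measure_display) (T : measurableType d) (P : probability T R).
Context (zeta : nat -> 'I_n -> 'I_n -> T -> R) (x0 : 'I_n -> R).
Hypothesis zeta_ok : noise_ok eta zeta.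

Local Notation X := (hk_traj r x0 zeta).
Local Notation hist := (hist_events r x0 zeta).

Fixpoint missed (W : nat -> set T) (L : nat) (A : set T) (s m : nat) : set T :=
  if m is m'.+1 then missed W L A s m' `\` W (s + m' * L)%N else A.

Lemma missedP W L A s m w :
  missed W L A s m w <-> A w /\ forall k, (k < m)%N -> ~ W (s + k * L)%N w.
Proof.
elim: m => [|m IH] /=; first by split=> [//|[]].
split=> [[/IH[Aw nW] nWm]|[Aw nW]].
  by split=> // k; rewrite ltnS leq_eqVlt => /predU1P[->//|]; exact: nW.
by split; [apply/IH; split=> // k km; apply: nW; exact: ltnW|exact: nW].
Qed.

Lemma hist_missed W L A s m : (forall t, hist (t + L)%N (W t)) -> hist s A ->
  hist (s + m * L)%N (missed W L A s m).
Proof.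
move=> hW hA; elim: m => [|m IH] /=; first by rewrite mul0n addn0.
have le : (s + m * L <= s + m.+1 * L)%N by rewrite leq_add2l leq_mul2r leqnSn orbT.
apply: hist_setD; first exact: hist_le IH.
by rewrite mulSn addnCA addnC; exact: hW.
Qed.

(** The failure of the earlier windows is known when the next one opens, so each new window
    multiplies the probability by at most [1 - p]. *)
Lemma pr_missed W L p A s m : 0 <= p <= 1 -> (forall t, hist (t + L)%N (W t)) ->
  (forall t B, hist t B -> p * pr P B <= pr P (B `&` W t)) -> hist s A ->
  pr P (missed W L A s m) <= (1 - p) ^+ m * pr P A.
Proof.
move=> p01 hW pW hA; elim: m => [|m IH] /=; first by rewrite expr0 mul1r.
have hM := hist_missed (m := m) hW hA.
rewrite pr_setD; [|exact: (hist_measurable zeta_ok hM)|exact: (hist_measurable zeta_ok (hW _))].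
have := pW _ _ hM; rewrite exprS -mulrA.
have : (1 - p) * pr P (missed W L A s m) <= (1 - p) * ((1 - p) ^+ m * pr P A).
  by rewrite ler_wpM2l//; lra.
lra.
Qed.

Lemma reaches_from_any L p S t A : reaches r P zeta x0 L p (fun=> True) S -> hist t A ->
  p * pr P A <= pr P (A `&` hits r zeta x0 S t L).
Proof.
move=> rS hA; have := rS t A hA.
by rewrite (_ : [set w | True] = setT) ?setIT.
Qed.

Lemma eq0_of_le_expr (p a : R) : 0 < p <= 1 -> 0 <= a -> (forall m, a <= (1 - p) ^+ m) -> a = 0.
Proof.
move=> p01 a0 H; apply/eqP; rewrite eq_le a0 andbT.
have q1 : `|1 - p| < 1 by rewrite ger0_norm; lra.
by apply: (cvgr_to_ge (cvg_expr q1)); near=> m; exact: H.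
Unshelve. all: by end_near.
Qed.

(** Never visiting [S] after [s] means missing every window, an event of probability at most
    [(1 - p) ^+ m] for all [m]; countably many [s] are then combined. *)
Lemma ae_infinitely_often L p S : mpred S -> 0 < p <= 1 ->
  reaches r P zeta x0 L p (fun=> True) S ->
  {ae P, forall w, forall s, exists u, (s <= u)%N /\ S (X u w)}.
Proof.
move=> mS p01 rS; apply: ae_foralln => s.
have hW t : hist (t + L.+1)%N (hits r zeta x0 S t L).
  by apply: hist_hits => //; rewrite leq_add2l.
pose N : set T := ~` (\bigcup_u [set w | (s <= u)%N /\ S (X u w)]).
have mN : measurable N.
  apply: measurableC; apply: bigcupT_measurable => u.
  by apply: (@measurable_pred _ _ _ _ _ _ _ _ zeta_ok (fun x => (s <= u)%N /\ S x)); apply: mpred_and => //; exact: mpred_const.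
have hT : hist s [set: T] by rewrite (_ : setT = [set w | True])//; exact: hist_const.
suff N0 : P N = 0%E.
  by exists N; split=> // w /= nS [u _ [su Su]]; apply: nS; exists u.
rewrite (prE P mN) (@eq0_of_le_expr p _ p01 (pr_ge0 _ _))// => m.
have mM := hist_measurable zeta_ok (hist_missed (m := m) hW hT).
have NM : pr P N <= pr P (missed (fun t => hits r zeta x0 S t L) L.+1 setT s m).
  apply: pr_le => // w nS; apply/missedP; split=> // k km [u [/andP[su _] Su]].
  by apply: nS; exists u => //; split=> //; apply: leq_trans su; exact: leq_addr.
apply: le_trans NM _; have : (1 - p) ^+ m * pr P setT <= (1 - p) ^+ m.
  by rewrite ler_piMr ?pr_le1// exprn_ge0//; lra.
apply: le_trans; apply: pr_missed => //; first by lra.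
by move=> t B hB; exact: reaches_from_any.
Qed.

Lemma next_hitP (Q : nat -> Prop) s0 s : next_hit Q s0 = Some s <->
  [/\ (s0 < s)%N, Q s & forall u, (s0 < u < s)%N -> ~ Q u].
Proof.
rewrite /next_hit; case: pselect => [h|h]; last first.
  by split=> // -[s0s Qs _]; exfalso; apply: h; exists s; apply/asboolP.
case: ex_minnP => m /asboolP[s0m Qm] mmin; split=> [[<-]|[s0s Qs smin]].
  split=> // u /andP[s0u um] Qu.
  suff : (m <= u)%N by rewrite leqNgt um.
  by apply: mmin; exact/asboolP.
congr Some; apply/eqP; rewrite eqn_leq mmin; last exact/asboolP.
rewrite leqNgt; apply/negP => ms; apply: (smin m) => //; exact/andP.
Qed.

Lemma next_hit_le (Q : nat -> Prop) s0 u : (s0 < u)%N -> Q u ->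
  exists2 s, next_hit Q s0 = Some s & (s <= u)%N.
Proof.
move=> s0u Qu; rewrite /next_hit; case: pselect => [h|h]; last first.
  by exfalso; apply: h; exists u; apply/asboolP.
by eexists; first reflexivity; case: ex_minnP => m _; apply; apply/asboolP.
Qed.

Section StoppingTimes.
Variables alpha c : R.
Let D w s := diam (X s w).
Let level k (x : 'I_n -> R) := if odd k then diam x <= alpha else c <= diam x.

Let mlevel k : mpred (level k).
Proof.
by rewrite /level; case: (odd k); [exact: mpred_diam_le|exact: mpred_diam_ge].
Qed.

(** The stopping-time property: the event splits over the previous time [s' < s], with the level met
    at [s] and at no time strictly between. *)
Lemma hist_tau k s : hist s [set w | tau (D w) alpha c k = Some s].
Proof.
elim: k s => [|k IH] s; first exact: (@hist_const _ _ r _ _ zeta x0 s (Some 0%N = Some s)).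
rewrite (_ : [set _ | _] = \bigcup_s' ([set w | (s' < s)%N] `&`
    ([set w | tau (D w) alpha c k = Some s'] `&` [set w | level k.+1 (X s w)] `\`
     \bigcup_u ([set w | (s' < u < s)%N] `&` [set w | level k.+1 (X u w)])))); last first.
  apply/seteqP; split=> w /=.
    case E : (tau _ _ _ k) => [s'|//] /next_hitP[s's Qs smin].
    exists s' => //; split=> //; split=> // -[u _ [su Qu]]; exact: (smin u).
  move=> [s' _ [s's [[-> Qs] smin]]]; apply/next_hitP; split=> // u su Qu.
  by apply: smin; exists u.
apply: hist_bigcup => s'; have [s's|s's] := boolP (s' < s)%N; last first.
  rewrite (_ : _ `&` _ = [set w | False]); first exact: hist_const.
  by apply/seteqP; split=> w [].
apply: hist_setI; first exact: hist_const.
apply: hist_setD; first apply: hist_setI.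
- by apply: hist_le (IH s'); exact: ltnW.
- exact: (@hist_mpred _ _ _ _ _ _ _ (level k.+1)).
- apply: hist_bigcup => u; have [us|us] := boolP (s' < u < s)%N.
    apply: hist_setI; first exact: hist_const.
    by apply: (@hist_mpred _ _ _ _ _ _ _ (level k.+1)) => //; case/andP: us => _ /ltnW.
  rewrite (_ : _ `&` _ = [set w | False]); first exact: hist_const.
  by apply/seteqP; split=> w [].
Qed.

Lemma measurable_tau k s : measurable [set w | tau (D w) alpha c k = Some s].
Proof. exact: (hist_measurable zeta_ok (@hist_tau k s)). Qed.

Lemma measurable_gap j t : measurable (gap_event D alpha c j t).
Proof.
rewrite (_ : gap_event _ _ _ _ _ = ~` \bigcup_a \bigcup_b
   ([set w | tau (D w) alpha c (2 * j + 2) = Some a] `&`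
    [set w | tau (D w) alpha c (2 * j) = Some b] `&`
    [set w | ~ t < (a - b)%:R])); last first.
  apply/seteqP; split=> w /=; rewrite /gap_event /=.
    by move=> gw [a _ [b _ [[ta tb] nt]]]; apply: nt; move: gw; rewrite /= ta tb.
  case Ea : (tau _ _ _ (2 * j + 2)) => [a|//]; case Eb : (tau _ _ _ (2 * j)) => [b|//].
  by move=> H; apply: contrapT => nt; apply: H; exists a => //; exists b.
apply: measurableC; apply: bigcupT_measurable => a; apply: bigcupT_measurable => b.
apply: measurableI; first by apply: measurableI; exact: measurable_tau.
by apply: (@measurable_pred _ _ r _ _ _ _ x0 zeta_ok (fun=> ~ t < (a - b)%:R) 0); exact: mpred_const.
Qed.

Variables (L1 L2 : nat) (p1 p2 : R).
Hypotheses (p101 : 0 < p1 <= 1) (p201 : 0 < p2 <= 1).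
Hypothesis low : reaches r P zeta x0 L1 p1 (fun=> True) (fun x => diam x <= alpha).
Hypothesis high : reaches r P zeta x0 L2 p2 (fun=> True) (fun x => c <= diam x).

(** It starts at [s.+1] because [next_hit] is strict, and the search for the high level opens only
    after that for the low level has closed, so the visits come in the right order. It ends at
    [s + L1 + L2 + 2]. *)
Definition window s : set T :=
  hits r zeta x0 (fun x => diam x <= alpha) s.+1 L1 `&`
  hits r zeta x0 (fun x => c <= diam x) (s + L1).+2 L2.

Let L := (L1 + L2).+2.

Lemma hist_window s : hist (s + L)%N (window s).
Proof.
apply: hist_setI; apply: hist_hits; [exact: mpred_diam_le| |exact: mpred_diam_ge|].
  by rewrite /L addSn -addnS leq_add2l ltnS -addnS leq_addr.
by rewrite /L !addSn !addnS addnA.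
Qed.

Lemma pr_window s A : hist s A -> p1 * p2 * pr P A <= pr P (A `&` window s).
Proof.
move=> hA; rewrite /window setIA.
have := reaches_from_any low (hist_le (leqnSn s) hA) => le1.
have hA1 : hist (s + L1).+2 (A `&` hits r zeta x0 (fun x => diam x <= alpha) s.+1 L1).
  apply: hist_setI; first by apply: hist_le hA; rewrite -!addnS leq_addr.
  by apply: hist_hits; [exact: mpred_diam_le|rewrite addSn leqnSn].
apply: le_trans (reaches_from_any high hA1).
have /andP[/ltW p20 _] := p201.
by apply: le_trans (ler_wpM2l p20 le1); rewrite mulrA (mulrC p2).
Qed.

Lemma ae_tau_some k : {ae P, forall w, exists s, tau (D w) alpha c k = Some s}.
Proof.
have io1 := ae_infinitely_often (mpred_diam_le alpha) p101 low.
have io2 := ae_infinitely_often (mpred_diam_ge c) p201 high.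
apply: filterS2 io1 io2 => w w1 w2; elim: k => [|k [s ks]]; first by exists 0%N.
have [u [su Qu]] : exists u, (s.+1 <= u)%N /\ level k.+1 (X u w).
  by rewrite /level; case: (odd k.+1).
by have [v ? ?] := @next_hit_le (fun u => level k.+1 (X u w)) s u su Qu; exists v; rewrite /= ks.
Qed.

(** Conditioning on [tau (2 * j) = b]: a gap longer than [t] makes the [m] consecutive windows after
    [b] fail. The geometric bounds are summed over the disjoint events [Tb b]; the event that this
    time is infinite is null. *)
Lemma pr_gap j t : 0 <= t ->
  (P (gap_event D alpha c j t) <= ((1 - p1 * p2) ^+ Num.truncn (t / L%:R))%:E)%E.
Proof.
move=> t0; set m := Num.truncn _; set q := 1 - _.
have p01 : 0 <= p1 * p2 <= 1.
  by have := p101; have := p201 => /andP[? ?] /andP[? ?]; apply/andP; split; nra.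
have q0 : 0 <= q ^+ m by rewrite exprn_ge0// /q; lra.
pose Tb b : set T := [set w | tau (D w) alpha c (2 * j) = Some b].
pose M b := missed window L (Tb b) b m.
pose N : set T := ~` \bigcup_b Tb b.
have mT b : measurable (Tb b) by exact: measurable_tau.
have mTb : measurable (\bigcup_b Tb b) by apply: bigcupT_measurable.
have mM b : measurable (M b).
  exact: (hist_measurable zeta_ok (hist_missed (m := m) hist_window (@hist_tau (2 * j) b))).
have mN : measurable N by apply: measurableC.
have N0 : P N = 0%E.
  apply: measure_negligible => //; apply: negligibleS (ae_tau_some (2 * j)).
  by move=> w /= nT [s ws]; apply: nT; exists s.
have sub : gap_event D alpha c j t `<=` N `|` \bigcup_b M b.
  move=> w gw; have [[b _ wb]|?] := pselect ((\bigcup_b Tb b) w); last by left.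
  right; exists b => //; apply/missedP; split=> // k km.
  (* If window [k < m] succeeded, the next two stopping times would be at most [u] and [v], and
     [v <= b + m * L] with [m * L <= t] contradicts the gap. *)
  move=> [[u [/andP[bu uL] lu]] [v [/andP[bv vL] hv]]].
  move: gw; rewrite /gap_event /= wb addn2 /= wb.
  have bu' : (b < u)%N by apply: leq_trans bu; rewrite ltnS leq_addr.
  have odd1 : odd (2 * j).+1 by rewrite /= oddM.
  rewrite -[~~ _]/(odd (2 * j).+1) odd1 /=.
  have [s1 -> s1u] := @next_hit_le (fun s => D w s <= alpha) b u bu' lu.
  have s1v : (s1 < v)%N.
    by apply: leq_ltn_trans s1u _; apply: leq_ltn_trans uL _; rewrite addSn; exact: bv.
  have [s2 -> s2v] := @next_hit_le (fun s => c <= D w s) s1 v s1v hv.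
  apply/negP; rewrite -leNgt.
  have : (s2 - b <= m * L)%N.
    rewrite leq_subLR; apply: leq_trans s2v _; apply: leq_trans vL _.
    have : (k.+1 * L <= m * L)%N by rewrite leq_mul2r km orbT.
    by move: (m * L)%N => mL; rewrite mulSn /L; lia.
  rewrite -(ler_nat R) => /le_trans; apply.
  rewrite natrM -ler_pdivlMr ?ltr0n//.
  by rewrite /m truncn_le divr_ge0.
have mMb : measurable (\bigcup_b M b) by apply: bigcupT_measurable.
apply: (@le_trans _ _ (P (N `|` \bigcup_b M b))).
  by apply: le_measure; rewrite ?inE//; [exact: measurable_gap|exact: measurableU].
apply: le_trans (measureU2 _ mN mMb) _; rewrite [X in (X + _)%E]N0 add0e.
have := measure_sigma_subadditive P mM mMb (@subset_refl _ _).
move=> /le_trans; apply.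
(* The starting event is kept as a factor in each bound, so that disjointness makes the series at
   most [q ^+ m]. *)
apply: (@le_trans _ _ (\sum_(0 <= b <oo) ((q ^+ m)%:E * P (Tb b)))%E).
  apply: lee_nneseries => [//|b _].
  rewrite [X in (X <= _)%E](prE P (mM b)) (prE P (mT b)) -EFinM lee_fin.
  by apply: pr_missed => //; [exact: hist_window|exact: pr_window|exact: hist_tau].
rewrite nneseriesZl//.
have tT : trivIset setT Tb.
  by apply/trivIsetP => a b _ _ ab; apply/seteqP; split=> // w [] /[swap] wb; rewrite /Tb /= wb => -[/eqP]; rewrite eq_sym (negbTE ab).
have := measure_bigcup P setT Tb (fun b _ => mT b) tT.
rewrite (eq_eseriesl (Q := xpredT)); last by move=> b; rewrite in_setT.
move=> <-; rewrite [X in (_ * X)%E](prE P mTb) -EFinM lee_fin.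
by rewrite ler_piMr// pr_le1.
Qed.

End StoppingTimes.

End Recurrence.

(** The upper limit is an infimum of suprema over neighbourhoods of infinity: the first condition
    supplies one good neighbourhood, the second bounds all suprema from below. *)
Lemma limn_esup_eq (R : realType) (u : nat -> R) (l : R) :
  (exists N, forall s, (N <= s)%N -> u s <= l) ->
  (forall e, 0 < e -> forall N, exists s, (N <= s)%N /\ l - e <= u s) ->
  limn_esup (fun s => (u s)%:E) = l%:E.
Proof.
move=> [N ul] lu; apply/eqP; rewrite eq_le; apply/andP; split.
  apply: ge_ereal_inf; exists (ereal_sup [set (u s)%:E | s in [set s | (N <= s)%N]]).
    by exists [set s | (N <= s)%N] => //; exists N.
  by apply: ge_ereal_sup => _ [s /= Ns <-]; rewrite lee_fin ul.
apply: le_ereal_inf_tmp => _ [V [M _ MV] <-]; apply/lee_subgt0Pr => e e0.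
have [s [Ms us]] := lu e e0 M.
apply: (@le_trans _ _ (u s)%:E); first by rewrite -EFinB lee_fin.
by apply: ereal_sup_ubound; exists s => //; exact: MV.
Qed.

(** * The two regimes of the noise amplitude, and the limits of the diameter *)

Section Main.
Context (R : realType) (n : nat) (r eta rho : R).
Hypotheses (n3 : (3 <= n)%N) (nr : (n%:R - 1)^-1 <= r) (r1 : r < 1).
Hypotheses (eta0 : 0 < eta) (rho0 : 0 < rho).

Let delta : R := (1 - n%:R^-1) * eta.

Let n2 : (2 : R) < n%:R. Proof. by rewrite ltr_nat. Qed.

Lemma dbarE : 2 * eta * (n%:R - 1) / n%:R = 2 * delta.
Proof. by have := n2; rewrite /delta => ?; field; lra. Qed.

(** The threshold says that the largest spread one step can create from a common average stays
    within the confidence radius. *)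
Lemma small_noiseE : (eta <= n%:R * r / (2 * (n%:R - 1))) = (2 * delta <= r).
Proof.
have := n2 => n2'.
by rewrite -dbarE ler_pdivlMr ?ler_pdivrMr; lra.
Qed.

Lemma reach_low alpha : 0 < alpha ->
  reach r eta rho (fun=> True) (fun x : 'I_n -> R => diam x <= alpha).
Proof.
move=> alpha0; apply: (reach_trans (reach_zero n3 nr r1 eta0 rho0)).
apply: reach_sub; [exact: mpred_at_zero|exact: mpred_diam_le|].
move=> x x01 x0; apply/diam_leP; first exact: ltW.
by move=> i j; have := x01 j; have := x0 i; lra.
Qed.

Lemma reach_high alpha : 0 < alpha ->
  reach r eta rho (fun=> True) (fun x : 'I_n -> R => c_alpha n r eta alpha <= diam x).
Proof.
move=> alpha0; apply: (reach_trans (reach_zero n3 nr r1 eta0 rho0)).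
rewrite /c_alpha small_noiseE dbarE; case: leP => dr.
  exact: reach_spread.
exact: reach_one.
Qed.

Section Trajectories.
Context (d : measure_display) (T : measurableType d) (P : probability T R).
Context (zeta : nat -> 'I_n -> 'I_n -> T -> R) (x0 : 'I_n -> R).
Hypotheses (zeta_ok : noise_ok eta zeta) (A2 : assumption_A2 P r eta rho x0 zeta).
Hypothesis x001 : in01 x0.

Local Notation X := (hk_traj r x0 zeta).

Lemma ae_reach S : reach r eta rho (fun=> True) S ->
  {ae P, forall w, forall s, exists u, (s <= u)%N /\ S (X u w)}.
Proof.
move=> [_ mS [L [p [p01 rS]]]].
exact: (ae_infinitely_often zeta_ok mS p01 (rS _ _ _ _ _ zeta_ok A2 x001)).
Qed.

(** Since [2 * delta <= r], the bound produced by one step restores the hypothesis for the next. *)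
Lemma traj_bounded w u : 2 * delta <= r -> pairwise_le r (X u w) ->
  forall s, (u < s)%N -> pairwise_le (2 * delta) (X s w).
Proof.
move=> dr xu.
have r0 : 0 < r by apply: lt_le_trans nr; rewrite invr_gt0; have := n2; lra.
have step s : pairwise_le r (X s w) -> pairwise_le (2 * delta) (X s.+1 w).
  move=> xs; apply: (pairwise_le_bounded r0 (ltW eta0)) => //; first exact: traj_in01.
  by case: zeta_ok => _ [zb z0]; split=> // i j _ _; exact: zb.
elim=> [//|s IH]; rewrite ltnS leq_eqVlt => /predU1P[<-|us]; first exact: step.
by apply: step => i j; apply: le_trans dr; exact: IH.
Qed.

Lemma ae_liminf_limsup : {ae P, forall w,
  limn_einf (fun s => (diam (X s w))%:E) = 0%E /\
  limn_esup (fun s => (diam (X s w))%:E) = (dbar_val n r eta)%:E}.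
Proof.
have io0 := ae_reach (reach_zero n3 nr r1 eta0 rho0).
(* The tolerances [k.+1^-1] are countably many and tend to [0], so one null set suffices. *)
have ioh : {ae P, forall w, forall k : nat, forall s, exists u, (s <= u)%N /\
    c_alpha n r eta k.+1%:R^-1 <= diam (X u w)}.
  apply: ae_foralln => k; apply: (ae_reach (reach_high _)).
  by rewrite invr_gt0.
apply: filterS2 io0 ioh => w w0 wh; split.
  (* The lower limit is minus the upper limit of the opposite sequence, which is at most [0] and
     returns to [0] whenever all agents sit at [0]. *)
  rewrite /limn_einf (_ : (fun s => - _)%E = (fun s => (- diam (X s w))%:E))//.
  rewrite (@limn_esup_eq _ _ 0) ?oppe0//.
    by exists 0%N => s _; rewrite oppr_le0 diam_ge0.
  move=> e e0 N; have [s [Ns xs]] := w0 N; exists s; split=> //.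
  have : diam (X s w) <= 0.
    by apply/diam_leP => // i j; have := traj_in01 r zeta x001 s w j; have := xs i; lra.
  lra.
apply: limn_esup_eq; last first.
  move=> e e0 N; have [s [Ns]] := wh (Num.truncn e^-1) N.
  rewrite /c_alpha /dbar_val => xs; exists s; split=> //.
  have : (Num.truncn e^-1).+1%:R^-1 <= e.
    by rewrite -[leRHS]invrK lef_pV2 ?posrE ?invr_gt0// ltW// truncnS_gt.
  move: xs; set a := _.+1%:R^-1; set b := 2 * eta * _ / _.
  by case: ifP => _; lra.
rewrite /dbar_val small_noiseE dbarE; case: leP => dr; last first.
  exists 0%N => s _; apply/diam_leP => // i j.
  by have := traj_in01 r zeta x001 s w i; have := traj_in01 r zeta x001 s w j; lra.
(* A time with all agents at [0] has diameter at most [r], after which the diameter stays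
   trapped. *)
have [u [_ xu]] := w0 0%N; exists u.+1 => s us.
have := n2; have := eta0 => ? ?.
apply/diam_leP.
  by rewrite mulr_ge0// /delta mulr_ge0 ?(ltW eta0)// subr_ge0 invf_le1; lra.
apply: (@traj_bounded _ u) => // i j.
have r0 : 0 < r by apply: lt_le_trans nr; rewrite invr_gt0; lra.
have := traj_in01 r zeta x001 u w j; have := xu i; lra.
Qed.

End Trajectories.
End Main.

Theorem theorem5 (R : realType) (n : nat) (r eta rho : R) :
  (3 <= n)%N -> (n%:R - 1)^-1 <= r -> r < 1 -> 0 < eta -> 0 < rho ->
  (forall (d : measure_display) (T : measurableType d) (P : probability T R)
     (zeta : nat -> 'I_n -> 'I_n -> T -> R) (x0 : 'I_n -> R),
     noise_ok eta zeta -> assumption_A2 P r eta rho x0 zeta ->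
     (forall i, 0 <= x0 i <= 1) ->
     {ae P, forall w,
        limn_einf (fun s => (diam (hk_traj r x0 zeta s w))%:E) = 0%E /\
        limn_esup (fun s => (diam (hk_traj r x0 zeta s w))%:E) = (dbar_val n r eta)%:E})
  /\
  (forall alpha : R, 0 < alpha ->
     exists lambda Lambda : R, 0 < lambda < 1 /\ 0 < Lambda /\
     forall (d : measure_display) (T : measurableType d) (P : probability T R)
       (zeta : nat -> 'I_n -> 'I_n -> T -> R) (x0 : 'I_n -> R),
       noise_ok eta zeta -> assumption_A2 P r eta rho x0 zeta ->
       (forall i, 0 <= x0 i <= 1) ->
       forall (j : nat) (t : R), 0 <= t ->
         (P (gap_event (fun w s => diam (hk_traj r x0 zeta s w))
                       alpha (c_alpha n r eta alpha) j t)
          <= ((1 - lambda) ^+ Num.truncn (t / Lambda))%:E)%E).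
Proof.
move=> n3 nr r1 eta0 rho0; split=> [d T P zeta x0 zok A2 x01|alpha alpha0].
  exact: (ae_liminf_limsup n3 nr r1 eta0 rho0 zok A2 x01).
have [_ _ [L1 [p1 [p101 low]]]] := reach_low n3 nr r1 eta0 rho0 alpha0.
have [_ _ [L2 [p2 [p201 high]]]] := reach_high n3 nr r1 eta0 rho0 alpha0.
have p12 : 0 < p1 * p2 <= 1.
  by move: p101 p201 => /andP[? ?] /andP[? ?]; apply/andP; split; nra.
(* The product [p1 * p2] may equal [1]; halving it gives a rate strictly below [1] and only weakens
   the bound. *)
exists (p1 * p2 / 2), (L1 + L2).+2%:R; split; first lra.
split; first by rewrite ltr0n.
move=> d T P zeta x0 zok A2 x01 j t t0.
apply: le_trans (pr_gap zok p101 p201 (low _ _ _ _ _ zok A2 x01)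
  (high _ _ _ _ _ zok A2 x01) j t0) _.
by rewrite lee_fin lerXn2r ?nnegrE; lra.
Qed.
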